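(* Consider the stochastic harmonic oscillator with additive noise $$dP=-Q\,dt+\sigma\,dW(t),\quad P(0)=p_0,\qquad dQ=P\,dt,\quad Q(0)=q_0,$$ where $P,Q$ are real-valued, $\sigma\in\mathbb{R}$ and $W$ is a standard Wiener process, and let $H_0(p,q)=\frac12(p^2+q^2)$. Let $b_1=\frac{-2+\sqrt6}{6}$ or $b_1=\frac{-2-\sqrt6}{6}$. Then the scheme SSRK-$0.5$-$b_1$ is of mean-square order $2.0$ and preserves the linear growth property exactly: for every step-size $h$, its numerical solution $(P_k,Q_k)$ at $t_k=kh$ satisfies $$\mathbb{E}\big(H_0(P_k,Q_k)\big)=\frac12(p_0^2+q_0^2)+\frac12\sigma^2t_k .$$
   Context: The scheme SSRK-$0.5$-$b_1$ (for $-\sqrt{2/3}<b_1<\sqrt{2/3}$), applied to the stochastic harmonic oscillator $dP=-Q\,dt+\sigma\,dW(t)$, $P(0)=p_0$, $dQ=P\,dt$, $Q(0)=q_0$ (with $P,Q$ real-valued, $\sigma\in\mathbb{R}$ and $W$ a standard Wiener process), written as $dX=f(X)\,dt+g\,dW(t)$ with $X=(P,Q)^\top$, $f(p,q)=(-q,p)^\top$, $g=(\sigma,0)^\top$, is as follows. With $y_k=(P_k,Q_k)^\top$, $y_0=(p_0,q_0)^\top$, $t_k=kh$, $I=W(t_{k+1})-W(t_k)$, $I_{10}=\int_{t_k}^{t_{k+1}}\int_{t_k}^{s}dW(u)\,ds$, $$Y_1=y_k+\tfrac h4 f(Y_1)+\left(b_1I+d_1\tfrac{I_{10}}{h}\right)g,$$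 $$Y_2=y_k+\tfrac h2 f(Y_1)+\tfrac h4 f(Y_2)+\left(-b_1I+d_2\tfrac{I_{10}}{h}\right)g,$$ $$y_{k+1}=y_k+\tfrac h2\big(f(Y_1)+f(Y_2)\big)+I\,g,$$ where $d_1=1-\frac{3b_1}{2}-\frac12\sqrt{2-3b_1^2}$ and $d_2=1+\frac{3b_1}{2}+\frac12\sqrt{2-3b_1^2}$. The initial values $p_0,q_0$ are deterministic real numbers. For the exact solution, $\mathbb{E}\,H_0(P(t),Q(t))=\frac12(p_0^2+q_0^2)+\frac12\sigma^2t$ (the linear growth property). A numerical solution $\{y_k\}$ on $[0,T]$ with $h=T/N$ has mean-square order $p>0$ if $\big(\mathbb{E}|y_k-X(t_k)|^2\big)^{1/2}=O(h^p)$ as $h\to0$, for $k=0,\dots,N$ (i.e. with a constant independent of $h$ and $k$). *)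

(* Defs.v *)
From HB Require Import structures.
From mathcomp Require Import all_boot all_order all_algebra ring.
From mathcomp Require Import all_classical all_reals all_analysis.

Set Implicit Arguments.
Unset Strict Implicit.
Unset Printing Implicit Defensive.

Import Order.TTheory GRing.Theory Num.Theory.
Import numFieldTopology.Exports numFieldNormedType.Exports.

Local Open Scope classical_set_scope.
Local Open Scope ring_scope.

(* Only the variables indexed by t >= 0 are constrained. Conditions on paths
   are almost sure. *)
Record wiener_process (R : realType) (d : measure_display)
    (Omega : measurableType d) (P : probability Omega R)
    (W : R -> {RV P >-> R}) : Prop := WienerProcess {
  wiener_start : {ae P, forall w, W 0 w = 0} ;
  wiener_continuous :
    {ae P, forall w, {within `[0, +oo[, continuous (fun t : R => W t w)}} ;
  wiener_gaussian : forall s t : R, 0 <= s -> s < t ->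
    forall A : set R, measurable A ->
      P [set w | A (W t w - W s w)] = normal_prob 0 (Num.sqrt (t - s)) A ;
  wiener_independent : forall (n : nat) (t : nat -> R) (A : nat -> set R),
    0 <= t 0%N -> (forall i, (i < n)%N -> t i < t i.+1) ->
    (forall i, measurable (A i)) ->
      P (\bigcap_(i < n) [set w | A i (W (t i.+1) w - W (t i) w)]) =
      (\prod_(i < n) P [set w | A i (W (t i.+1) w - W (t i) w)%R])%E }.

(* The state (p, q) is encoded as a pair in R * R, with its product
   sigma-algebra and its product topology. *)
Definition sho_drift (R : realType) (x : R * R) : R * R := (- x.2, x.1).

Definition sho_noise (R : realType) (sigma : R) : R * R := (sigma, 0).

Definition H0 (R : realType) (x : R * R) : R := (x.1 ^+ 2 + x.2 ^+ 2) / 2.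

(* Since the noise is additive, the stochastic integral of the constant sigma
   over [0, t] is sigma * (W t - W 0), so that the equation can be read
   pathwise. *)
Definition sho_solution (R : realType) (d : measure_display)
    (Omega : measurableType d) (P : probability Omega R)
    (W : R -> {RV P >-> R}) (sigma p0 q0 : R)
    (X : R -> {RV P >-> (R * R)%type}) : Prop :=
  {ae P, forall w,
    {within `[0, +oo[, continuous (fun t : R => X t w)} /\
    forall t : R, 0 <= t ->
      (X t w).1 = p0 + \int[lebesgue_measure]_(s in `[0, t])
                         (sho_drift (X s w)).1
                     + (sho_noise sigma).1 * (W t w - W 0 w) /\
      (X t w).2 = q0 + \int[lebesgue_measure]_(s in `[0, t])
                         (sho_drift (X s w)).2
                     + (sho_noise sigma).2 * (W t w - W 0 w)}.

Definition wiener_I (R : realType) (d : measure_display)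
    (Omega : measurableType d) (P : probability Omega R)
    (W : R -> {RV P >-> R}) (h : R) (k : nat) (w : Omega) : R :=
  W (k.+1%:R * h) w - W (k%:R * h) w.

(* The inner integral of dW over [t_k, s] is the increment W s - W t_k. *)
Definition wiener_I10 (R : realType) (d : measure_display)
    (Omega : measurableType d) (P : probability Omega R)
    (W : R -> {RV P >-> R}) (h : R) (k : nat) (w : Omega) : R :=
  \int[lebesgue_measure]_(s in `[k%:R * h, k.+1%:R * h])
    (W s w - W (k%:R * h) w).

Definition ssrk_d1 (R : realType) (b1 : R) : R :=
  1 - 3 * b1 / 2 - Num.sqrt (2 - 3 * b1 ^+ 2) / 2.

Definition ssrk_d2 (R : realType) (b1 : R) : R :=
  1 + 3 * b1 / 2 + Num.sqrt (2 - 3 * b1 ^+ 2) / 2.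

Definition ssrk_step (R : realType) (b1 h sigma I I10 : R)
    (y y' : R^o * R^o) : Prop :=
  exists Y1 Y2 : R^o * R^o,
  [/\ Y1 = y + (h / 4) *: sho_drift Y1
             + (b1 * I + ssrk_d1 b1 * (I10 / h)) *: sho_noise sigma,
      Y2 = y + (h / 2) *: sho_drift Y1 + (h / 4) *: sho_drift Y2
             + (- b1 * I + ssrk_d2 b1 * (I10 / h)) *: sho_noise sigma
    & y' = y + (h / 2) *: (sho_drift Y1 + sho_drift Y2)
             + I *: sho_noise sigma ].

(* The implicit stage equations are uniquely solvable for every step-size. *)
Lemma stage_solvable (R : realType) (c : R) (v : R^o * R^o) :
  exists! Y : R^o * R^o, Y = v + c *: sho_drift Y.
Proof.
have Ec (Y : R^o * R^o) :
    v + c *: sho_drift Y = (v.1 - c * Y.2 : R, v.2 + c * Y.1 : R).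
  by case: v => a b; congr pair; rewrite /= scalerN.
have D : 1 + c ^+ 2 != 0 by rewrite gt_eqF// ltr_wpDr// sqr_ge0.
exists ((v.1 - c * v.2) / (1 + c ^+ 2), (v.2 + c * v.1) / (1 + c ^+ 2)).
split=> [|[Y1 Y2]]; rewrite Ec; first by congr pair => /=; field.
move=> [e1 e2]; move: v.1 v.2 e1 e2 => a b e1 e2.
have -> : a = Y1 + c * Y2 by rewrite e1 subrK.
have -> : b = Y2 - c * Y1 by rewrite {1}e2 addrK.
by congr pair; apply: (mulIf D); rewrite mulfVK//; ring.
Qed.

Lemma ssrk_step_unique (R : realType) (b1 h sigma I I10 : R)
    (y : R^o * R^o) : exists! y', ssrk_step b1 h sigma I I10 y y'.
Proof.
have [Y1 [e1 u1]] := stage_solvable (h / 4)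
  (y + (b1 * I + ssrk_d1 b1 * (I10 / h)) *: sho_noise sigma).
have [Y2 [e2 u2]] := stage_solvable (h / 4) (y + (h / 2) *: sho_drift Y1 +
  (- b1 * I + ssrk_d2 b1 * (I10 / h)) *: sho_noise sigma).
exists (y + (h / 2) *: (sho_drift Y1 + sho_drift Y2) + I *: sho_noise sigma).
split; first by exists Y1, Y2; split=> //; rewrite addrAC.
move=> y' [Z1 [Z2 [f1 f2 ->]]].
rewrite addrAC in f1; have E1 := u1 _ f1; subst Z1.
by rewrite addrAC in f2; rewrite (u2 _ f2).
Qed.

Definition ssrk_solution (R : realType) (d : measure_display)
    (Omega : measurableType d) (P : probability Omega R)
    (W : R -> {RV P >-> R}) (sigma p0 q0 b1 h : R)
    (y : nat -> {RV P >-> (R * R)%type}) : Prop :=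
  {ae P, forall w, y 0%N w = (p0, q0) /\
    forall k : nat,
      ssrk_step b1 h sigma (wiener_I W h k w) (wiener_I10 W h k w)
        (y k w) (y k.+1 w)}.

(* Written out because the library's norm on R * R is the sup norm. *)
Definition euclid_norm (R : realType) (x : R * R) : R :=
  Num.sqrt (x.1 ^+ 2 + x.2 ^+ 2).

(* y h k is the approximation of X (k h) with step-size h; on [0, T] the
   step-sizes are h = T / N, so that h --> 0 means N --> oo. *)
Definition mean_square_order (R : realType) (d : measure_display)
    (Omega : measurableType d) (P : probability Omega R)
    (X : R -> {RV P >-> (R * R)%type})
    (y : R -> nat -> {RV P >-> (R * R)%type}) (T p : R) : Prop :=
  exists C : R, \forall N \near \oo, forall k : nat, (k <= N)%N ->
    let h := T / N%:R in
    (poweR 'E_P[fun w => (euclid_norm (y h k w - X (k%:R * h) w) ^+ 2)%R] 2^-1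
       <= (C * powR h p)%R%:E)%E.

(* Main.v *)
From HB Require Import structures.
Require Import Defs.
From mathcomp Require Import all_boot all_order all_algebra ring lra.
From mathcomp Require Import all_classical all_reals all_analysis measurable_realfun.

Import Order.TTheory GRing.Theory Num.Theory.
Import numFieldTopology.Exports numFieldNormedType.Exports.

Set Implicit Arguments.
Unset Strict Implicit.
Unset Printing Implicit Defensive.

Local Open Scope classical_set_scope.
Local Open Scope ring_scope.

(** Write a state [(p, q)] as the complex number [p + i * q]. The drift is then
    multiplication by [i], and both one-step maps are a rotation followed by a
    noise that is linear in the increments of [W] during the step:
    - the scheme multiplies by [m ^ 2], where [m = (1 + i * h / 4) /
      (1 - i * h / 4)], and adds [sigma] times a combination of [I] and [I10]
      ([ssrk_stepE]);
    - the exact flow multiplies by [exp (i * h)] and adds [sigma] times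
      [I + i * int exp (i * (t' - s)) * (W s - W t) ds], the integral being
      over the step from [t] to [t'] ([sho_path_step]).

    Everything is read off the first two moments of the increments of [W]. The
    Gaussian law gives increments of mean [0] and variance [|t - s|],
    polarisation gives all covariances ([wiener_increment_cov]), and Fubini's
    theorem for a version of [W] all of whose paths are continuous extends them
    to time integrals ([ip_time_integral]). In particular the noise of a step is orthogonal to
    everything built from constants and from the noise of earlier steps
    ([ip_step_functional_past]).

    Linear growth: [|m| = 1] and the cross terms vanish, so the energy grows at
    each step by [sigma ^ 2 / 2] times the second moment of the noise of the
    scheme. That moment is [h] times a polynomial in [b1], [d1], [d2] and the
    real and imaginary parts of [m], and for the two values of [b1] it is exactly [h]
    ([noise_variance], [ssrk_energy]).

    Order two: the error satisfies [e' = exp (i * h) * e +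
    (m ^ 2 - exp (i * h)) * y + sigma * F], where [F] is the difference of the
    two noises. The rotations differ by [O(h ^ 3)], the second moment of the
    numerical solution [y] is known from the first part, and [F] is orthogonal
    to the other terms with variance [O(h ^ 5)]. Hence [E |e'| ^ 2 <=
    (1 + h) * E |e| ^ 2 + C * h ^ 5] ([error_step]), and a discrete Gronwall
    inequality gives [E |e| ^ 2 = O(h ^ 4)] on a bounded interval
    ([error_bound]). *)

(** * Integrals on the line and Gaussian moments *)

Section real_line.
Context {R : realType}.
Local Notation mu := (@lebesgue_measure R).
Implicit Types (f F : R -> R) (a b s c : R).

Lemma continuous_integrable_itv f a b :
  continuous f -> mu.-integrable `[a, b] (EFin \o f).
Proof.
move=> cf; apply: continuous_compact_integrable; first exact: segment_compact.
exact: continuous_subspaceT.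
Qed.

(** The rules below are stated for explicit functions, so that the derivative
    of a closed expression is obtained by composing them as terms. *)
Lemma is_derive_cst_fun (a x : R) : is_derive x (1 : R) (fun=> a) 0.
Proof. exact: is_derive_cst. Qed.

Lemma is_derive_id_fun (x : R) : is_derive x (1 : R) (fun y => y) 1.
Proof. exact: is_derive_id. Qed.

Lemma is_derive_add f F (x a b : R) : is_derive x (1 : R) f a ->
  is_derive x (1 : R) F b -> is_derive x (1 : R) (fun y => f y + F y) (a + b).
Proof. by move=> df dF; exact: is_deriveD. Qed.

Lemma is_derive_opp f (x a : R) : is_derive x (1 : R) f a ->
  is_derive x (1 : R) (fun y => - f y) (- a).
Proof. by move=> df; exact: is_deriveN. Qed.

Lemma is_derive_mul f F (x a b : R) : is_derive x (1 : R) f a ->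
  is_derive x (1 : R) F b ->
  is_derive x (1 : R) (fun y => f y * F y) (a * F x + f x * b).
Proof.
move=> df dF; have /(@is_derive_eq _ _ _ _ _ _ _ _) := is_deriveM df dF.
by apply; rewrite addrC [_ *: _]mulrC.
Qed.

Lemma is_derive_chain f F (x a b : R) : is_derive (F x) (1 : R) f a ->
  is_derive x (1 : R) F b -> is_derive x (1 : R) (fun y => f (F y)) (a * b).
Proof. by move=> df dF; exact: is_derive1_comp. Qed.

Lemma is_derive_continuous f F :
  (forall x : R, is_derive x (1 : R) F (f x)) -> continuous F.
Proof.
move=> dF x; apply/differentiable_continuous/derivable1_diffP.
by case: (dF x).
Qed.

Lemma integral_is_derive f F a b : a <= b -> continuous f ->
  (forall x : R, is_derive x (1 : R) F (f x)) ->
  (\int[mu]_(x in `[a, b]) (f x)%:E = (F b - F a)%:E)%E.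
Proof.
rewrite le_eqVlt => /predU1P[-> cf dF|ab cf dF].
  by rewrite set_itv1 integral_set1 subrr.
have cF := is_derive_continuous dF.
rewrite (@continuous_FTC2 _ f F)//.
- exact: continuous_subspaceT.
- split=> [x _| |].
  + by case: (dF x).
  + exact/cvg_at_right_filter/cF.
  + exact/cvg_at_left_filter/cF.
- by move=> x _; rewrite derive1E; case: (dF x).
Qed.

Lemma Rintegral_is_derive f F a b : a <= b -> continuous f ->
  (forall x : R, is_derive x (1 : R) F (f x)) ->
  \int[mu]_(x in `[a, b]) f x = F b - F a.
Proof. by move=> ab cf dF; rewrite /Rintegral (integral_is_derive ab cf dF). Qed.

Lemma Rintegral_quadratic (u v w a b : R) : a <= b ->
  \int[mu]_(s in `[a, b]) (u + v * (s - a) + w * (s - a) ^+ 2) =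
  u * (b - a) + v * (b - a) ^+ 2 / 2 + w * (b - a) ^+ 3 / 3.
Proof.
move=> ab; pose F (s : R) := u * (s - a) + v / 2 * ((s - a) * (s - a)) +
  w / 3 * ((s - a) * ((s - a) * (s - a))).
have d1 (x : R) := is_derive_add (is_derive_id_fun x) (is_derive_cst_fun (- a) x).
have d2 (x : R) := is_derive_mul (d1 x) (d1 x).
have d3 (x : R) := is_derive_mul (d1 x) (d2 x).
have cf : continuous (fun s : R => u + v * (s - a) + w * (s - a) ^+ 2).
  move=> x; have cx : (fun s : R => s - a) t @[t --> x] --> x - a.
    by apply: cvgB; [exact: cvg_id|exact: cvg_cst].
  apply: cvgD; first apply: cvgD; first exact: cvg_cst.
    by apply: cvgM cx; exact: cvg_cst.
  by apply: cvgM; [exact: cvg_cst|exact: (cvgM cx cx)].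
have dF (x : R) : is_derive x (1 : R) F (u + v * (x - a) + w * (x - a) ^+ 2).
  apply: (is_derive_eq (is_derive_add (is_derive_add
    (is_derive_mul (is_derive_cst_fun u x) (d1 x))
    (is_derive_mul (is_derive_cst_fun (v / 2) x) (d2 x)))
    (is_derive_mul (is_derive_cst_fun (w / 3) x) (d3 x)))).
  by rewrite /=; field.
by rewrite (Rintegral_is_derive ab cf dF) /F; field.
Qed.

Lemma Rintegral_split f a s b : a <= s -> s <= b -> continuous f ->
  \int[mu]_(t in `[a, b]) f t =
  \int[mu]_(t in `[a, s]) f t + \int[mu]_(t in `[s, b]) f t.
Proof.
move=> as_ sb cf; have iab x y := @continuous_integrable_itv f x y cf.
rewrite -(@Rintegral_itv_obnd_cbnd _ s); last first.
  by apply: integrableS (iab s b) => //; exact: subset_itv_oc_cc.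
by rewrite -(@Rintegral_itvB _ _ (BLeft a) (BRight b)) ?bnd_simp//; ring.
Qed.

Lemma cvg_integral_symmetric_itv f : (forall x, 0 <= f x) ->
  measurable_fun setT f ->
  (\int[mu]_(x in `[(- n%:R)%R, n%:R%R]) (f x)%:E)%E @[n --> \oo]
    --> (\int[mu]_x (f x)%:E)%E.
Proof.
move=> f0 mf.
have UT : \bigcup_n `[- (n%:R : R), n%:R]%classic = [set: R].
  apply/seteqP; split=> // x _; exists (Num.truncn `|x|).+1 => //=.
  rewrite in_itv/= -ler_norml ltW//.
  by have /andP[] := Num.Theory.truncn_itv (normr_ge0 x).
rewrite -UT; apply: ge0_nondecreasing_set_cvg_integral => //.
- move=> m n mn; apply/subsetPset => x /=; rewrite !in_itv/= -!ler_norml.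
  by move=> /le_trans; apply; rewrite ler_nat.
- by move=> n; apply/measurable_EFinP; exact: measurable_funTS.
- by move=> n x _; rewrite lee_fin.
Qed.

Lemma normal_pdf0E s x : 0 < s ->
  normal_pdf 0 s x = normal_peak s * expR (- (x ^+ 2 / (s ^+ 2 *+ 2))).
Proof.
move=> s0; rewrite normal_pdfE ?gt_eqF//=; congr (_ * _).
by rewrite /normal_fun subr0 mulNr.
Qed.

(** The factor growing linearly is beaten by the Gaussian because
    [exp (- u) <= 1 / u]. *)
Lemma cvg_normal_pdf_linear s a b : 0 < s ->
  (a * n%:R + b) * normal_pdf 0 s n%:R @[n --> \oo] --> (0 : R).
Proof.
move=> s0; pose K : R := (`|a| + `|b|) * normal_peak s * (s ^+ 2 *+ 2) * 2.
have h0 c : c * harmonic n @[n --> \oo] --> (0 : R).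
  by rewrite -[X in _ --> X](mulr0 c); apply: cvgM;
    [exact: cvg_cst|exact: cvg_harmonic].
apply: (@squeeze_cvgr _ _ _ _ (fun n => - K * harmonic n)
  (fun n => K * harmonic n));
  [|exact: h0|exact: h0].
near=> n.
have n0 : 0 < n%:R :> R by rewrite ltr0n; near: n; exact: nbhs_infty_gt.
have n1 : 1 <= n%:R :> R by rewrite ler1n; near: n; exact: nbhs_infty_gt.
rewrite mulNr -ler_norml normrM (ger0_norm (normal_pdf_ge0 _ _ _)).
rewrite normal_pdf0E//; set u := n%:R ^+ 2 / _.
have u0 : 0 < u by rewrite divr_gt0 ?exprn_gt0// mulrn_wgt0// exprn_gt0.
have le1 : expR (- u) <= u^-1.
  rewrite expRN lef_pV2 ?posrE ?expR_gt0//.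
  by apply: le_trans (expR_ge1Dx u); rewrite lerDr.
have le2 : `|a * n%:R + b| <= (`|a| + `|b|) * n%:R.
  rewrite (le_trans (ler_normD _ _))// normrM (ger0_norm (ltW n0)) mulrDl lerD2l.
  by rewrite ler_peMr.
have pk0 := normal_peak_ge0 s.
apply: le_trans (_ : (`|a| + `|b|) * n%:R * (normal_peak s * u^-1) <= _).
  by apply: ler_pM => //; rewrite ?mulr_ge0 ?expR_ge0// ler_wpM2l.
have -> : (`|a| + `|b|) * n%:R * (normal_peak s * u^-1) =
    (`|a| + `|b|) * normal_peak s * (s ^+ 2 *+ 2) * n%:R^-1.
  by rewrite /u; field; rewrite !gt_eqF.
rewrite /K /= -[leRHS]mulrA; apply: ler_wpM2l.
  by rewrite !mulr_ge0 ?addr_ge0 ?sqr_ge0.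
rewrite -[2]invrK -invfM lef_pV2 ?posrE ?mulr_gt0 ?invr_gt0// -natr1.
by rewrite ler_pdivrMl//; lra.
Unshelve. all: by end_near. Qed.

(** The function [- s ^ 2 * (x + 2 * c) * pdf x] is an antiderivative of
    [((x + c) ^ 2 - (s ^ 2 + c ^ 2)) * pdf x] that vanishes at infinity. *)
Lemma normal_pdf_moment2 s c : 0 < s ->
  (\int[mu]_x ((x + c) ^+ 2 * normal_pdf 0 s x)%:E = (s ^+ 2 + c ^+ 2)%:E)%E.
Proof.
move=> s0.
have s2 : s ^+ 2 *+ 2 != 0 by rewrite mulrn_eq0/= expf_eq0/= gt_eqF.
pose F x := - s ^+ 2 * (x + 2 * c) * normal_pdf 0 s x.
have cpdf : continuous (normal_pdf 0 s : R -> R).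
  by apply: continuous_normal_pdf; rewrite gt_eqF.
have dpdf (x : R) : is_derive x (1 : R) (normal_pdf 0 s) (- (x / s ^+ 2) * normal_pdf 0 s x).
  rewrite (_ : normal_pdf 0 s =
    (fun x => normal_peak s * expR (- (x ^+ 2 / (s ^+ 2 *+ 2))))).
    have d2 := is_derive_mul (is_derive_id_fun x) (is_derive_id_fun x).
    have d3 := is_derive_opp (is_derive_mul d2
      (is_derive_cst_fun (s ^+ 2 *+ 2)^-1 x)).
    have d4 := is_derive_mul (is_derive_cst_fun (normal_peak s) x)
      (is_derive_chain (is_derive_expR _) d3).
    apply: (is_derive_eq d4).
    by rewrite /=; field; rewrite gt_eqF.
  by apply/funext => z; rewrite normal_pdf0E.
have dF (x : R) : is_derive x (1 : R) F
    ((x + c) ^+ 2 * normal_pdf 0 s x - (s ^+ 2 + c ^+ 2) * normal_pdf 0 s x).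
  have d1 := is_derive_mul (is_derive_cst_fun (- s ^+ 2) x)
    (is_derive_add (is_derive_id_fun x) (is_derive_cst_fun (2 * c) x)).
  apply: (is_derive_eq (is_derive_mul d1 (dpdf x))).
  by rewrite /=; field; rewrite gt_eqF.
have cg : continuous (fun x => (x + c) ^+ 2 * normal_pdf 0 s x).
  move=> x; apply: cvgM; last exact: cpdf.
  apply: (cvg_comp (fun x => x + c) (fun x => x ^+ 2)); last exact: sqr_continuous.
  by apply: cvgD; [exact: cvg_id|exact: cvg_cst].
have g0 x : 0 <= (x + c) ^+ 2 * normal_pdf 0 s x.
  by rewrite mulr_ge0 ?sqr_ge0 ?normal_pdf_ge0.
have cvg_pdf := @cvg_integral_symmetric_itv _ (normal_pdf_ge0 0 s)
  (measurable_normal_pdf 0 s).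
rewrite integral_normal_pdf in cvg_pdf.
have mg : measurable_fun setT (fun x : R => (x + c) ^+ 2 * normal_pdf 0 s x).
  exact: continuous_measurable_fun.
have cvg_g := @cvg_integral_symmetric_itv _ g0 mg.
rewrite -(cvg_lim _ cvg_g)//; apply/cvg_lim => //.
have cpdf' : continuous (fun x => (s ^+ 2 + c ^+ 2) * normal_pdf 0 s x : R).
  by move=> x; apply: cvgM; [exact: cvg_cst|exact: cpdf].
have En n : (\int[mu]_(x in `[(- n%:R)%R, n%:R%R])
      ((x + c) ^+ 2 * normal_pdf 0 s x)%:E =
    (F n%:R - F (- n%:R))%:E +
    (s ^+ 2 + c ^+ 2)%:E * \int[mu]_(x in `[(- n%:R)%R, n%:R%R])
      (normal_pdf 0 s x)%:E)%E.
  have nn : - n%:R <= n%:R :> R by have := ler0n R n; lra.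
  rewrite -integralZl//=; last exact: continuous_integrable_itv.
  rewrite -(integral_is_derive nn _ dF); last first.
    by move=> x; apply: cvgB; [exact: cg|exact: cpdf'].
  rewrite -integralD//=.
  - by apply: eq_integral => x _; rewrite -EFinM -EFinD subrK.
  - apply: continuous_integrable_itv => x.
    by apply: cvgB; [exact: cg|exact: cpdf'].
  - exact: continuous_integrable_itv.
rewrite (funext En) -[X in _ --> X]add0e -[X in _ --> (_ + X)%E]mule1.
apply: cvgeD => //; last exact: cvgeZl.
apply: cvg_EFin; first by near=> n.
rewrite /= (_ : _ \o _ = fun n => - s ^+ 2 *
  ((2 * n%:R + 0) * normal_pdf 0 s (n%:R : R))).
  rewrite -[X in _ --> X](mulr0 (- s ^+ 2)); apply: cvgM;
    [exact: cvg_cst|exact: cvg_normal_pdf_linear].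
apply/funext => n /=; rewrite /F.
rewrite !normal_pdf0E// sqrrN; ring.
Unshelve. all: by end_near. Qed.

Lemma ge0_integral_normal_prob s f : 0 < s -> (forall x, 0 <= f x) ->
  measurable_fun setT f ->
  (\int[normal_prob 0 s]_x (f x)%:E =
   \int[mu]_x (f x * normal_pdf 0 s x)%:E)%E.
Proof.
move=> s0 f0 mf.
have dom := @normal_prob_dominates R 0 s.
rewrite -(Radon_Nikodym_SigmaFinite.change_of_variables dom)//; last first.
  exact/measurable_EFinP.
have iRN := Radon_Nikodym_SigmaFinite.f_integrable dom.
apply: ge0_ae_eq_integral => //.
- apply: emeasurable_funM; first exact/measurable_EFinP.
  exact: measurable_int iRN.
- by apply/measurable_EFinP/measurable_funM => //; exact: measurable_normal_pdf.
- move=> x _; apply: mule_ge0; first by rewrite lee_fin.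
  exact: Radon_Nikodym_SigmaFinite.f_ge0.
- by move=> x _; rewrite lee_fin mulr_ge0// normal_pdf_ge0.
- have : ae_eq mu setT (Radon_Nikodym_SigmaFinite.f (normal_prob 0 s) mu)
      (EFin \o normal_pdf 0 s).
    apply: integral_ae_eq => //.
      by apply/measurable_EFinP; exact: measurable_normal_pdf.
    by move=> E _ mE; rewrite -Radon_Nikodym_SigmaFinite.f_integral.
  by apply: filterS => x /= + _ => ->//; rewrite EFinM.
Qed.

End real_line.
(** * Square integrable variables *)

Section square_integrable.
Context d (Omega : measurableType d) (R : realType) (P : probability Omega R).
Implicit Types (f g : Omega -> R) (c s : R).

Definition sqint f : Prop :=
  measurable_fun setT f /\ P.-integrable setT (fun w => (f w ^+ 2)%:E).

(** The inner product of [L ^ 2 (P)], as a real number. *)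
Definition ip f g : R := \int[P]_w (f w * g w).

Lemma sqint_mul f g : sqint f -> sqint g ->
  P.-integrable setT (fun w => (f w * g w)%:E).
Proof.
move=> [mf if2] [mg ig2].
apply: le_integrable (integrableD _ if2 ig2) => //.
  exact/measurable_EFinP/measurable_funM.
move=> w _ /=; rewrite lee_fin normrM.
rewrite [leRHS]ger0_norm ?addr_ge0 ?sqr_ge0// -(real_normK (num_real (f w))).
rewrite -(real_normK (num_real (g w))).
move: (normr_ge0 (f w)) (normr_ge0 (g w)); nra.
Qed.

Lemma sqint_cst c : sqint (fun=> c).
Proof.
split; first exact: measurable_cst.
by apply: finite_measure_integrable_cst.
Qed.

Lemma sqint_scale c f : sqint f -> sqint (fun w => c * f w).
Proof.
move=> [mf if2]; split; first exact: measurable_funM.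
rewrite (_ : (fun _ => _) = (fun w => (c ^+ 2)%:E * (f w ^+ 2)%:E)%E).
  exact: integrableZl.
by apply/funext => w; rewrite exprMn EFinM.
Qed.

Lemma sqint_add f g : sqint f -> sqint g -> sqint (fun w => f w + g w).
Proof.
move=> Lf Lg; have [mf if2] := Lf; have [mg ig2] := Lg.
split; first exact: measurable_funD.
rewrite (_ : (fun _ => _) = (fun w => ((f w ^+ 2)%:E + (g w ^+ 2)%:E) +
    (2%:E * (f w * g w)%:E))%E).
  apply: integrableD => //; first exact: integrableD.
  by apply: integrableZl => //; exact: sqint_mul.
by apply/funext => w; rewrite -EFinM -!EFinD; congr EFin; ring.
Qed.

Lemma sqint_opp f : sqint f -> sqint (fun w => - f w).
Proof.
move=> /(sqint_scale (-1)); congr sqint; apply/funext => w; exact: mulN1r.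
Qed.

Lemma sqint_sub f g : sqint f -> sqint g -> sqint (fun w => f w - g w).
Proof. by move=> Lf /sqint_opp; exact: sqint_add. Qed.

Lemma ipC f g : ip f g = ip g f.
Proof. by rewrite /ip; congr Rintegral; apply/funext => w; rewrite mulrC. Qed.

Lemma ip_addl f g k : sqint f -> sqint g -> sqint k ->
  ip (fun w => f w + g w) k = ip f k + ip g k.
Proof.
move=> Lf Lg Lk; rewrite /ip -RintegralD//; try exact: sqint_mul.
by congr Rintegral; apply/funext => w; rewrite mulrDl.
Qed.

Lemma ip_scalel c f k : sqint f -> sqint k ->
  ip (fun w => c * f w) k = c * ip f k.
Proof.
move=> Lf Lk; rewrite /ip -RintegralZl//; last exact: sqint_mul.
by congr Rintegral; apply/funext => w; rewrite mulrA.
Qed.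

Lemma ip_oppl f k : sqint f -> sqint k -> ip (fun w => - f w) k = - ip f k.
Proof.
move=> Lf Lk; rewrite -mulN1r -ip_scalel//; congr ip.
by apply/funext => w; rewrite mulN1r.
Qed.

Lemma ip_subl f g k : sqint f -> sqint g -> sqint k ->
  ip (fun w => f w - g w) k = ip f k - ip g k.
Proof.
by move=> Lf Lg Lk; rewrite ip_addl ?ip_oppl//; exact: sqint_opp.
Qed.

Lemma ip_addr f g k : sqint f -> sqint g -> sqint k ->
  ip k (fun w => f w + g w) = ip k f + ip k g.
Proof. by move=> Lf Lg Lk; rewrite ipC ip_addl// !(ipC k). Qed.

Lemma ip_scaler c f k : sqint f -> sqint k ->
  ip k (fun w => c * f w) = c * ip k f.
Proof. by move=> Lf Lk; rewrite ipC ip_scalel// (ipC k). Qed.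

Lemma ip_ge0 f : 0 <= ip f f.
Proof. by apply: Rintegral_ge0 => w _; rewrite -expr2 sqr_ge0. Qed.

Lemma ip_add_sqr f g : sqint f -> sqint g ->
  ip (fun w => f w + g w) (fun w => f w + g w) =
  ip f f + 2 * ip f g + ip g g.
Proof.
move=> Lf Lg; have L := sqint_add Lf Lg.
rewrite ip_addl// !ip_addr// (ipC g f); ring.
Qed.

Lemma ip_add_le f g : sqint f -> sqint g ->
  ip (fun w => f w + g w) (fun w => f w + g w) <= 2 * ip f f + 2 * ip g g.
Proof.
move=> Lf Lg; rewrite ip_add_sqr//.
have LNg := sqint_opp Lg.
have E : ip f (fun w => - g w) = - ip f g by rewrite ipC ip_oppl// ipC.
have E2 : ip (fun w => - g w) (fun w => - g w) = ip g g.
  by rewrite ip_oppl// ipC ip_oppl// opprK.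
have := ip_ge0 (fun w => f w + - g w).
rewrite ip_add_sqr// E E2; lra.
Qed.

Lemma ip_cst c : ip (fun=> c) (fun=> c) = c ^+ 2.
Proof.
rewrite /ip Rintegral_cst// -expr2 -[RHS]mulr1; congr (_ * _).
by move/(congr1 fine) : (probability_setT P).
Qed.

Lemma expectation_sqr f : sqint f ->
  (\int[P]_w (f w ^+ 2)%:E = (ip f f)%:E)%E.
Proof.
move=> [_ if2]; rewrite /ip /Rintegral fineK//; last exact: integrable_fin_num.
Qed.

Lemma expectation_sum_sqr c f g : sqint f -> sqint g ->
  ('E_P[fun w => ((f w ^+ 2 + g w ^+ 2) * c)%R] = ((ip f f + ip g g) * c)%:E)%E.
Proof.
move=> Lf Lg; rewrite unlock.
have iD : P.-integrable setT (fun w => ((f w ^+ 2)%:E + (g w ^+ 2)%:E)%E).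
  by apply: integrableD => //; [case: Lf|case: Lg].
under eq_integral => w _ do rewrite EFinM EFinD.
rewrite integralZr// integralD//; [|by case: Lf|by case: Lg].
by rewrite !expectation_sqr.
Qed.

Lemma ae_eq_sqint f g : measurable_fun setT g -> {ae P, forall w, f w = g w} ->
  sqint f -> sqint g.
Proof.
move=> mg fg [mf if2]; split=> //.
have mg2 : measurable_fun setT (fun w => (g w ^+ 2)%:E).
  by apply/measurable_EFinP; exact: measurable_funX.
apply/integrableP; split=> //; move/integrableP : if2 => [mf2].
congr (_ < _)%E; apply: ge0_ae_eq_integral => //.
- exact: measurableT_comp.
- exact: measurableT_comp.
- by apply: filterS fg => w /= -> _.
Qed.

Lemma ae_eq_ip f g f' g' :
  measurable_fun setT f -> measurable_fun setT g ->
  measurable_fun setT f' -> measurable_fun setT g' ->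
  {ae P, forall w, f w = f' w} -> {ae P, forall w, g w = g' w} ->
  ip f g = ip f' g'.
Proof.
move=> mf mg mf' mg' ff' gg'; rewrite /ip /Rintegral; congr fine.
apply: ae_eq_integral => //; try exact/measurable_EFinP/measurable_funM.
by apply: filterS2 ff' gg' => w /= -> -> _.
Qed.

(** Testing the law against [(x + c) ^ 2] for [c = 0] and [c = 1] gives the
    second moment and, by difference, the mean. *)
Lemma normal_law_moments f s : 0 < s -> measurable_fun setT f ->
  (forall A : set R, measurable A -> P [set w | A (f w)] = normal_prob 0 s A) ->
  [/\ sqint f, ip f (fun=> 1) = 0 & ip f f = s ^+ 2].
Proof.
move=> s0 mf law.
have E c : (\int[P]_w ((f w + c) ^+ 2)%:E = (s ^+ 2 + c ^+ 2)%:E)%E.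
  have mc : measurable_fun setT (fun x : R => (x + c) ^+ 2).
    by apply: measurable_funX; exact: measurable_funD.
  rewrite -(normal_pdf_moment2 c s0) -ge0_integral_normal_prob//; last first.
    by move=> x; exact: sqr_ge0.
  have := @ge0_integral_pushforward _ _ Omega (measurableTypeR R) R f mf P setT
    (fun x => ((x + c) ^+ 2)%:E).
  rewrite preimage_setT => <-//; last 2 first.
    exact/measurable_EFinP.
    by move=> x _; rewrite lee_fin sqr_ge0.
  have mf' : measurable_fun setT (f : Omega -> measurableTypeR R) by exact: mf.
  pose fm : {mfun Omega >-> measurableTypeR R} :=
    HB.pack f (isMeasurableFun.Build _ _ _ _ _ mf').
  apply: (@eq_measure_integral _ (measurableTypeR R) _ _ _
    (pushforward P fm)) => A mA _.
  exact: law.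
have E0 : (\int[P]_w (f w ^+ 2)%:E = (s ^+ 2)%:E)%E.
  have := E 0; rewrite expr0n addr0 => <-.
  by apply: eq_integral => w _; rewrite addr0.
have Lf : sqint f.
  split=> //; apply/integrableP; split.
    by apply/measurable_EFinP; exact: measurable_funX.
  under eq_integral => w _ do rewrite gee0_abs ?lee_fin ?sqr_ge0//.
  by rewrite E0 ltry.
have Ef : ip f f = s ^+ 2 by rewrite /ip /Rintegral E0.
split=> //; have := E 1; rewrite expectation_sqr; last first.
  exact: sqint_add (sqint_cst _).
move=> [].
have L1 := sqint_cst 1.
have Lf1 : sqint (fun w => f w + 1) by exact: sqint_add.
rewrite ip_addl// !ip_addr// ip_cst Ef (ipC _ f); lra.
Qed.

End square_integrable.
(** * Covariances of the Wiener process *)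

Section wiener_second_order.
Context d (Omega : measurableType d) (R : realType) (P : probability Omega R).
Context (W : R -> {RV P >-> R}) (hW : wiener_process W).
Implicit Types (s t a b : R).

(** The law is given for [s < t] only; the other cases follow by symmetry. *)
Lemma wiener_increment_moments s t : 0 <= s -> 0 <= t ->
  [/\ sqint P (fun w => W t w - W s w),
      ip P (fun w => W t w - W s w) (fun=> 1) = 0 &
      ip P (fun w => W t w - W s w) (fun w => W t w - W s w) = `|t - s| ].
Proof.
have lt_case u v : 0 <= u -> u < v ->
    [/\ sqint P (fun w => W v w - W u w),
      ip P (fun w => W v w - W u w) (fun=> 1) = 0 &
      ip P (fun w => W v w - W u w) (fun w => W v w - W u w) = v - u ].
  move=> u0 uv; have uv0 : 0 < v - u by rewrite subr_gt0.
  have mI : measurable_fun setT (fun w => W v w - W u w).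
    exact: measurable_funB.
  have := @normal_law_moments _ _ _ P _ (Num.sqrt (v - u)) _ mI
    (wiener_gaussian hW u0 uv).
  by rewrite sqrtr_gt0 sqr_sqrtr ?ltW//; apply.
move=> s0 t0; have [st|ts|<-] := ltgtP s t.
- by rewrite gtr0_norm ?subr_gt0//; exact: lt_case.
- have [L E1 E2] := lt_case _ _ t0 ts.
  have -> : (fun w => W t w - W s w) = (fun w => - (W s w - W t w)).
    by apply/funext => w; rewrite opprB.
  rewrite ltr0_norm ?subr_lt0// opprB; split; first exact: sqint_opp.
    by rewrite ip_oppl ?E1 ?oppr0//; exact: sqint_cst.
  by rewrite ip_oppl ?(ipC _ _ (fun w => - _)) ?ip_oppl ?opprK//; exact: sqint_opp.
- rewrite subrr normr0.
  have -> : (fun w => W s w - W s w) = (fun w => 0 * 1).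
    by apply/funext => w; rewrite subrr mul0r.
  by split; rewrite ?ip_scalel ?mul0r//; try exact: sqint_cst.
Qed.

Lemma sqint_wiener_increment s t : 0 <= s -> 0 <= t ->
  sqint P (fun w => W t w - W s w).
Proof. by move=> s0 t0; have [] := wiener_increment_moments s0 t0. Qed.

(** Polarisation: the variances [|t - s|] of all increments already
    determine their covariances. *)
Lemma wiener_increment_cov a b s t : 0 <= a -> 0 <= b -> 0 <= s -> 0 <= t ->
  ip P (fun w => W b w - W a w) (fun w => W t w - W s w) =
  (`|t - a| + `|b - s| - `|t - b| - `|s - a|) / 2.
Proof.
move=> a0 b0 s0 t0.
have L u v (u0 : 0 <= u) (v0 : 0 <= v) := sqint_wiener_increment u0 v0.
have V u v (u0 : 0 <= u) (v0 : 0 <= v) : ip P (fun w => W v w - W u w)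
    (fun w => W v w - W u w) = `|v - u|.
  by have [_ _ ->] := wiener_increment_moments u0 v0.
pose X u w := W u w - W a w.
have LX u : 0 <= u -> sqint P (X u) by exact: L.
have D u v : (fun w => W v w - W u w) = (fun w => X v w - X u w).
  by apply/funext => w; rewrite /X; ring.
have VX u : 0 <= u -> ip P (X u) (X u) = `|u - a| by exact: V.
have Xb : (fun w => W b w - W a w) = X b by [].
rewrite Xb (D s t); clearbody X.
have E u v : 0 <= u -> 0 <= v ->
    ip P (X u) (X v) = (`|u - a| + `|v - a| - `|v - u|) / 2.
  move=> u0 v0; rewrite -(V u v)// -(VX u)// -(VX v)// D.
  have LXu := LX _ u0; have LXv := LX _ v0.
  have LD := sqint_sub LXv LXu.
  rewrite ip_subl// !(ipC _ _ (fun w => X v w - X u w)) !ip_subl//.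
  rewrite (ipC _ (X v) (X u)); lra.
rewrite (ipC _ (X b)) ip_subl; [|exact: LX..].
by rewrite !E// (distrC b t) (distrC b s); lra.
Qed.

End wiener_second_order.
(** * Continuous paths and Fubini *)

Section paths.
Context {R : realType}.
Local Notation mu := (@lebesgue_measure R).
Implicit Types (f : R -> R) (a b : R).

Lemma continuous_within_clamp (T : topologicalType) (f : R -> T) :
  {within `[0, +oo[, continuous f} -> continuous (fun t : R => f (Num.max 0 t)).
Proof.
move=> /subspace_continuousP cf t.
have t0 : 0 <= Num.max 0 t by rewrite le_max lexx.
have := cf (Num.max 0 t); rewrite /= in_itv/= andbT => /(_ t0).
apply: cvg_comp => A [e /= e0 eA]; exists e => //= s ts.
apply: eA; last by rewrite /= in_itv/= andbT le_max lexx.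
move: ts; rewrite /ball/= !ltr_norml => /andP[ts1 ts2].
apply/andP; split; move: ts1 ts2;
  by have [] := leP 0 t; have [] := leP 0 s; lra.
Qed.

(** Cauchy-Schwarz against a constant: the mean [m] of [f] satisfies
    [0 <= int (f - m) ^ 2]. *)
Lemma sqr_Rintegral_le f a b : a < b -> continuous f ->
  (\int[mu]_(s in `[a, b]) f s) ^+ 2 <=
  (b - a) * \int[mu]_(s in `[a, b]) (f s ^+ 2).
Proof.
move=> ab cf; set I := \int[mu]_(s in _) f s; set J := \int[mu]_(s in _) _.
have ba0 : 0 < b - a by rewrite subr_gt0.
pose m := I / (b - a).
have cf2 : continuous (fun s => f s ^+ 2).
  by move=> x; apply: (cvg_comp f (fun x => x ^+ 2)) (cf x) _; exact: sqr_continuous.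
have cmf : continuous (fun s => 2 * m * f s).
  by move=> x; apply: cvgM; [exact: cvg_cst|exact: cf].
have iab g : continuous g -> mu.-integrable `[a, b] (EFin \o g).
  exact: continuous_integrable_itv.
have : 0 <= \int[mu]_(s in `[a, b]) ((f s ^+ 2 - 2 * m * f s) + m ^+ 2).
  apply: Rintegral_ge0 => s _.
  rewrite (_ : _ + _ = (f s - m) ^+ 2) ?sqr_ge0//; ring.
rewrite RintegralD//; last 2 first.
- by apply: iab => x; apply: cvgB; [exact: cf2|exact: cmf].
- by apply: iab => x; exact: cvg_cst.
rewrite RintegralB//; [|exact: iab..].
rewrite RintegralZl//; last exact: iab.
rewrite Rintegral_cst//= lebesgue_measure_itv/= lte_fin ab/= -/I -/J.
have -> : J - 2 * m * I + m ^+ 2 * (b - a) = J - I ^+ 2 / (b - a).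
  by rewrite /m; field; rewrite gt_eqF.
by rewrite subr_ge0 ler_pdivrMr// mulrC.
Qed.

End paths.

Section processes.
Context d (Omega : measurableType d) (R : realType) (P : probability Omega R).
Local Notation mu := (@lebesgue_measure R).
Implicit Types (B H : R -> Omega -> R) (a b M : R).

(** Freeze the time at the last grid point [k / (n + 1)]: preimages under the
    frozen process are countable unions of rectangles, and by continuity of the
    paths the frozen processes converge to the process. *)
Lemma measurable_continuous_process H :
  (forall s, measurable_fun setT (H s)) -> (forall w, continuous (H ^~ w)) ->
  measurable_fun setT (fun z : Omega * measurableTypeR R => H z.2 z.1).
Proof.
move=> mH cH.
pose grid n (s : R) := (Num.floor (s * n.+1%:R))%:~R / n.+1%:R : R.
apply: (@measurable_fun_cvg _ _ _ _
  (fun n (z : Omega * measurableTypeR R) => H (grid n z.2) z.1)) => [n|].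
  move=> _ A mA; rewrite setTI.
  have -> : (fun z : Omega * measurableTypeR R => H (grid n z.2) z.1) @^-1` A =
      \bigcup_(k : int) ((H (k%:~R / n.+1%:R) @^-1` A) `*`
        (`[k%:~R / n.+1%:R, (k + 1)%:~R / n.+1%:R[ : set (measurableTypeR R))).
    apply/seteqP; split=> [[w s] /= Aw|[w s] [k _ [/= Aw]]].
      exists (Num.floor (s * n.+1%:R)) => //; split=> //=.
      rewrite in_itv/= ler_pdivrMr// ltr_pdivlMr//.
      exact: Num.Theory.floor_itv.
    rewrite in_itv/= ler_pdivrMr// ltr_pdivlMr// => /Num.Theory.floor_def E.
    by rewrite /grid E.
  apply: countable_bigcupT_measurable => // k.
  apply: measurableX; last exact: measurable_itv.
  by rewrite -[X in measurable X]setTI; exact: mH.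
move=> [w s] _ /=.
apply: (cvg_comp (fun n => grid n s) (H ^~ w)); last exact: cH.
apply: (@squeeze_cvgr _ _ _ _ (fun n => s - harmonic n) (fun=> s)).
- near=> n; rewrite /grid /= ler_pdivrMr// Num.Theory.floor_le andbT.
  rewrite ler_pdivlMr// mulrBl mulVf// lerBlDr.
  have /andP[_ /ltW] := Num.Theory.floor_itv (s * n.+1%:R).
  by rewrite intrD.
- rewrite -[X in _ --> X]subr0; apply: cvgB; first exact: cvg_cst.
  exact: cvg_harmonic.
- exact: cvg_cst.
Unshelve. all: by end_near. Qed.

(** The bound on [E |H s|] makes [H], cut off outside [[a, b]], integrable for
    the product measure. *)
Lemma fubini_continuous_process H a b M : a <= b ->
  (forall s, measurable_fun setT (H s)) -> (forall w, continuous (H ^~ w)) ->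
  (forall s, a <= s <= b -> (\int[P]_w (`|H s w|)%:E <= M%:E)%E) ->
  [/\ P.-integrable setT (fun w => (\int[mu]_(s in `[a, b]) H s w)%:E),
      mu.-integrable `[a, b] (fun s => (\int[P]_w H s w)%:E) &
      \int[P]_w (\int[mu]_(s in `[a, b]) H s w) =
      \int[mu]_(s in `[a, b]) (\int[P]_w H s w)].
Proof.
move=> ab mH cH HM.
pose D : set (measurableTypeR R) := `[a, b]%classic.
pose f (z : Omega * measurableTypeR R) : \bar R := (H z.2 z.1 * \1_D z.2)%:E.
have mD : measurable D by exact: measurable_itv.
have mf : measurable_fun setT f.
  apply/measurable_EFinP/measurable_funM.
    exact: measurable_continuous_process.
  apply: (@measurableT_comp _ _ _ _ _ _ (\1_D : measurableTypeR R -> R) _ snd).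
    exact: measurable_indic.
  exact: measurable_snd.
have imf : (P \x mu)%E.-integrable setT f.
  apply/integrable21ltyP => //.
  have le_f s : (\int[P]_w `|f (w, s)| <= (M * \1_D s)%:E)%E.
    rewrite /f /= indicE; case: (boolP (s \in D)) => [|_].
      rewrite inE /D /= in_itv/= => sab; rewrite !mulr1.
      by under eq_integral => w _ do rewrite mulr1; exact: HM.
    rewrite mulr0; under eq_integral => w _ do rewrite mulr0 normr0.
    by rewrite integral0.
  apply: (@le_lt_trans _ _ (\int[mu]_s (M * \1_D s)%:E)%E).
    apply: ge0_le_integral => //.
    - by move=> s _; apply: integral_ge0.
    - apply: (measurable_fun_fubini_tonelli_G (abse \o f)) => //=.
      exact: measurableT_comp.
    - apply/measurable_EFinP/measurable_funM => //.
  apply: integrable_lty => //; under eq_fun do rewrite EFinM.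
  apply: integrableZl => //; exact: integrable_indic_itv.
have EF : fubini_F mu f = fun w => (\int[mu]_(s in `[a, b]) H s w)%:E.
  apply/funext => w; rewrite /fubini_F /Rintegral fineK; last first.
    by apply: integrable_fin_num => //; exact: continuous_integrable_itv.
  rewrite [RHS]integral_mkcond; apply: eq_integral => s _.
  by rewrite /f patchE indicE /= -/D; case: ifP; rewrite ?mulr1 ?mulr0.
have iH s : a <= s <= b -> P.-integrable setT (EFin \o H s).
  move=> sab; apply/integrableP; split; first exact/measurable_EFinP.
  by apply: le_lt_trans (ltry M); exact: HM.
have EG s : D s -> fubini_G P f s = (\int[P]_w H s w)%:E.
  move=> sD; rewrite /fubini_G /f /= indicE mem_set//.
  under eq_integral => w _ do rewrite mulr1.
  rewrite /Rintegral fineK//; apply: integrable_fin_num => //.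
  by apply: iH; move: sD; rewrite /D/= in_itv.
split.
- by rewrite -EF; exact: integrable_fubini_F.
- apply: (eq_integrable mD (fubini_G P f)).
    by move=> s; rewrite inE => /EG.
  have iM : mu.-integrable D (fun=> M%:E).
    by apply: (@continuous_integrable_itv _ (fun=> M)) => x; exact: cvg_cst.
  apply: le_integrable iM => //.
    by apply: measurable_funTS; exact: measurable_fubini_G imf.
  move=> s sD; rewrite EG//; rewrite /D/= in_itv/= in sD.
  rewrite /= lee_fin (le_trans (le_normr_Rintegral measurableT (iH s sD)))//.
  rewrite (le_trans _ (ler_norm M))// -lee_fin /Rintegral fineK ?HM//.
  by have /integrable_abse/integrable_fin_num := iH s sD; exact.
- rewrite {1}/Rintegral -EF [X in fine X](Fubini imf) [in RHS]/Rintegral.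
  rewrite [in RHS]integral_mkcond; congr fine; apply: eq_integral => s _.
  rewrite patchE -/D; case: ifPn => [|sD]; first by rewrite inE => /EG.
  rewrite /f /= indicE (negbTE sD).
  by under eq_integral => w _ do rewrite mulr0; rewrite integral0.
Qed.

End processes.
(** * Time integrals of processes *)

Section time_integrals.
Context d (Omega : measurableType d) (R : realType) (P : probability Omega R).
Local Notation mu := (@lebesgue_measure R).
Implicit Types (H : R -> Omega -> R) (Z : Omega -> R) (a b M : R).

Lemma integral_abs_mul_le f Z : sqint P f -> sqint P Z ->
  (\int[P]_w (`|f w * Z w|)%:E <= (ip P f f + ip P Z Z)%:E)%E.
Proof.
move=> Lf LZ; have [mf if2] := Lf; have [mZ iZ2] := LZ.
rewrite EFinD -!expectation_sqr// -integralD//.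
apply: ge0_le_integral => //.
- by apply/measurable_EFinP; apply: measurableT_comp => //; exact: measurable_funM.
- by apply: emeasurable_funD; apply/measurable_EFinP; exact: measurable_funX.
- move=> w _; rewrite -EFinD lee_fin normrM.
  rewrite -(real_normK (num_real (f w))) -(real_normK (num_real (Z w))).
  move: (normr_ge0 (f w)) (normr_ge0 (Z w)); nra.
Qed.

Section time_integral.
Context H a b M (ab : a < b)
  (mH : forall s, measurable_fun setT (H s)) (cH : forall w, continuous (H ^~ w))
  (LH : forall s, a <= s <= b -> sqint P (H s) /\ ip P (H s) (H s) <= M).

Let fubini_mul Z : sqint P Z ->
  [/\ P.-integrable setT (fun w => (\int[mu]_(s in `[a, b]) (H s w * Z w))%:E),
      mu.-integrable `[a, b] (fun s => (ip P (H s) Z)%:E) &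
      \int[P]_w (\int[mu]_(s in `[a, b]) (H s w * Z w)) =
      \int[mu]_(s in `[a, b]) ip P (H s) Z].
Proof.
move=> LZ; apply: (@fubini_continuous_process _ _ _ _ _ _ _ (M + ip P Z Z)).
- exact: ltW.
- by move=> s; apply: measurable_funM => //; case: LZ.
- by move=> w s; apply: cvgM; [exact: cH|exact: cvg_cst].
- move=> s /LH[LHs HM]; apply: le_trans (integral_abs_mul_le LHs LZ) _.
  by rewrite lee_fin lerD2r.
Qed.

Let fubini_sqr :
  [/\ P.-integrable setT
        (fun w => (\int[mu]_(s in `[a, b]) (H s w ^+ 2))%:E),
      mu.-integrable `[a, b] (fun s => (\int[P]_w (H s w ^+ 2))%:E) &
      \int[P]_w (\int[mu]_(s in `[a, b]) (H s w ^+ 2)) =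
      \int[mu]_(s in `[a, b]) (\int[P]_w (H s w ^+ 2))].
Proof.
apply: (@fubini_continuous_process _ _ _ _ _ _ _ M).
- exact: ltW.
- by move=> s; exact: measurable_funX.
- move=> w; rewrite (_ : (fun s => _) = (fun s => H s w * H s w))//.
  by move=> s; apply: cvgM; exact: cH.
- move=> s /LH[LHs HM]; under eq_integral => w _ do rewrite ger0_norm ?sqr_ge0//.
  by rewrite expectation_sqr// lee_fin.
Qed.

Let mulE Z w :
  \int[mu]_(s in `[a, b]) (H s w * Z w) = \int[mu]_(s in `[a, b]) H s w * Z w.
Proof. by rewrite RintegralZr//; exact: continuous_integrable_itv. Qed.

(** By the Cauchy-Schwarz inequality in time, the square of the integral is
    dominated by the integral of the square, which is integrable by Fubini. *)
Lemma sqint_time_integral : sqint P (fun w => \int[mu]_(s in `[a, b]) H s w).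
Proof.
have mI : measurable_fun setT (fun w => \int[mu]_(s in `[a, b]) H s w).
  have [/measurable_int + _ _] := fubini_mul (sqint_cst P 1).
  move=> /measurable_EFinP; congr measurable_fun; apply/funext => w.
  by rewrite mulE mulr1.
split=> //.
have [iH2 _ _] := fubini_sqr.
have iK := integrableZl measurableT (b - a) iH2.
apply: le_integrable iK => //.
  by apply/measurable_EFinP; exact: measurable_funX.
move=> w _ /=; rewrite !ger0_norm ?sqr_ge0//.
  by rewrite lee_fin; exact: sqr_Rintegral_le.
apply: mulr_ge0; first by rewrite subr_ge0 ltW.
by apply: Rintegral_ge0 => s _; exact: sqr_ge0.
Qed.

Lemma ip_time_integral Z : sqint P Z ->
  ip P (fun w => \int[mu]_(s in `[a, b]) H s w) Z =
  \int[mu]_(s in `[a, b]) ip P (H s) Z.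
Proof.
move=> LZ; have [_ _ <-] := fubini_mul LZ.
by rewrite /ip; congr Rintegral; apply/funext => w; rewrite mulE.
Qed.

Lemma ip_time_integral_le :
  ip P (fun w => \int[mu]_(s in `[a, b]) H s w)
       (fun w => \int[mu]_(s in `[a, b]) H s w) <= (b - a) ^+ 2 * M.
Proof.
have ba0 : 0 <= b - a by rewrite subr_ge0 ltW.
have [iH2 iE2 E2] := fubini_sqr; have LI := sqint_time_integral.
apply: (@le_trans _ _ (\int[P]_w ((b - a) *
    \int[mu]_(s in `[a, b]) (H s w ^+ 2)))).
  apply: le_Rintegral => //; first exact: sqint_mul.
    rewrite (_ : _ \o _ = (fun w => (b - a)%:E *
      (\int[mu]_(s in `[a, b]) (H s w ^+ 2))%:E)%E); last first.
      by apply/funext => w; rewrite -EFinM.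
    exact: integrableZl.
  by move=> w _; rewrite -expr2; exact: sqr_Rintegral_le.
rewrite RintegralZl// E2 expr2 -mulrA; apply: ler_wpM2l => //.
apply: (@le_trans _ _ (\int[mu]_(s in `[a, b]) M)).
  apply: le_Rintegral => //.
    by apply: continuous_integrable_itv => x; exact: cvg_cst.
  move=> s /=; rewrite in_itv/= => /LH[_]; apply: le_trans.
  by rewrite /ip; under eq_Rintegral do rewrite expr2.
by rewrite Rintegral_cst//= lebesgue_measure_itv/= lte_fin ab/= mulrC.
Qed.

End time_integral.

End time_integrals.
(** * The noise of one step and its orthogonality to the past *)

Section brownian.
Context d (Omega : measurableType d) (R : realType) (P : probability Omega R).
Local Notation mu := (@lebesgue_measure R).

(** The part of the Wiener process that the rest of the proof uses: continuity
    of every path and the first two moments of the increments. *)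
Record brownian_like (B : R -> Omega -> R) : Prop := BrownianLike {
  bl_measurable : forall s, measurable_fun setT (B s) ;
  bl_continuous : forall w, continuous (B ^~ w) ;
  bl_sqint : forall s t, 0 <= s -> 0 <= t -> sqint P (fun w => B t w - B s w) ;
  bl_mean : forall s t, 0 <= s -> 0 <= t ->
    ip P (fun w => B t w - B s w) (fun=> 1) = 0 ;
  bl_cov : forall a b s t, 0 <= a -> 0 <= b -> 0 <= s -> 0 <= t ->
    ip P (fun w => B b w - B a w) (fun w => B t w - B s w) =
    (`|t - a| + `|b - s| - `|t - b| - `|s - a|) / 2 }.

(** Put the paths to zero on a null set containing the discontinuous ones, and
    freeze them for negative times, so that continuity holds on the whole
    line. *)
Lemma wiener_continuous_version (W : R -> {RV P >-> R}) : wiener_process W ->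
  exists B, brownian_like B /\ {ae P, forall w, forall s, 0 <= s -> B s w = W s w}.
Proof.
move=> hW; have [N [mN PN subN]] := wiener_continuous hW.
pose B (s : R) w := W (Num.max 0 s) w * \1_(~` N) w.
have mNC : measurable (~` N) by exact: measurableC.
have mB s : measurable_fun setT (B s).
  by apply: measurable_funM => //; exact: measurable_indic.
have BW : {ae P, forall w, forall s, 0 <= s -> B s w = W s w}.
  exists N; split=> // w /=; apply: contra_notP => Nw s s0.
  by rewrite /B indicE mem_set// mulr1 max_r.
have incBW s t : 0 <= s -> 0 <= t ->
    {ae P, forall w, W t w - W s w = B t w - B s w}.
  by move=> s0 t0; apply: filterS BW => w BWw; rewrite !BWw.
have mWi s t : measurable_fun setT (fun w => W t w - W s w).
  exact: measurable_funB.
have mBi s t : measurable_fun setT (fun w => B t w - B s w).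
  exact: measurable_funB.
exists B; split=> //; split=> //.
- move=> w; case: (pselect (N w)) => [Nw|Nw] s.
    rewrite /B indicE memNset ?mulr0; last by rewrite /setC/= => /(_ Nw).
    by under eq_fun do rewrite mulr0; exact: cvg_cst.
  apply: cvgM; last exact: cvg_cst.
  apply: (@continuous_within_clamp R _ (fun t => W t w)).
  by apply: contrapT => cW; apply: Nw; exact: subN.
- move=> s t s0 t0.
  apply: ae_eq_sqint (sqint_wiener_increment hW s0 t0); first exact: mBi.
  exact: incBW.
- move=> s t s0 t0; have [_ <- _] := wiener_increment_moments hW s0 t0.
  apply: ae_eq_ip => //; last by apply: aeW.
  by apply: filterS (incBW _ _ s0 t0) => w ->.
- move=> a b s t a0 b0 s0 t0; rewrite -(wiener_increment_cov hW)//.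
  apply: ae_eq_ip => //.
    by apply: filterS (incBW _ _ a0 b0) => w ->.
  by apply: filterS (incBW _ _ s0 t0) => w ->.
Qed.

Variables (B : R -> Omega -> R) (hB : brownian_like B).
Implicit Types (a b c s t K : R) (g : R -> R).

(** Both the noise of the scheme (constant [g]) and the noise of the exact flow
    (trigonometric [g]) over the step from [a] to [b] have this form, hence so
    has their difference. *)
Definition step_functional a b c g (w : Omega) : R :=
  c * (B b w - B a w) + \int[mu]_(s in `[a, b]) (g s * (B s w - B a w)).

Section one_step.
Context a b g K (a0 : 0 <= a) (ab : a < b) (cg : continuous g)
  (gK : forall s, a <= s <= b -> `|g s| <= K).

Let ge0 s : a <= s <= b -> 0 <= s.
Proof. by case/andP => as_ _; exact: le_trans as_. Qed.

Let b0 : 0 <= b. Proof. by rewrite (le_trans a0)// ltW. Qed.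

Let H s w := g s * (B s w - B a w).

Let mH s : measurable_fun setT (H s).
Proof.
apply: measurable_funM => //; apply: measurable_funB; exact: bl_measurable.
Qed.

Let cH w : continuous (H ^~ w).
Proof.
move=> s; apply: cvgM; first exact: cg.
by apply: cvgB; [exact: bl_continuous|exact: cvg_cst].
Qed.

Let LH s : a <= s <= b ->
  sqint P (H s) /\ ip P (H s) (H s) <= K ^+ 2 * (b - a).
Proof.
move=> sab; have s0 := ge0 sab; have L := bl_sqint hB a0 s0.
split; first exact: (sqint_scale (g s) L).
rewrite /H ip_scalel ?ip_scaler//; last exact: (sqint_scale (g s) L).
rewrite bl_cov// mulrA -expr2; case/andP: sab => as_ sb.
rewrite !subrr normr0 !subr0 ger0_norm ?subr_ge0//.
have -> : (s - a + (s - a)) / 2 = s - a by lra.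
apply: ler_pM; rewrite ?sqr_ge0 ?subr_ge0//; last by rewrite lerD2r.
rewrite -(real_normK (num_real (g s))) lerXn2r ?nnegrE//.
  by rewrite (le_trans (normr_ge0 (g s)))// gK// as_ sb.
by rewrite gK// as_ sb.
Qed.

Lemma sqint_step_functional c : sqint P (step_functional a b c g).
Proof.
apply: sqint_add; first exact/sqint_scale/bl_sqint.
exact: sqint_time_integral ab mH cH LH.
Qed.

Lemma ip_step_functional c Z : sqint P Z ->
  ip P (step_functional a b c g) Z = c * ip P (fun w => B b w - B a w) Z +
    \int[mu]_(s in `[a, b]) (g s * ip P (fun w => B s w - B a w) Z).
Proof.
move=> LZ; have LI := sqint_time_integral ab mH cH LH.
have Lb := bl_sqint hB a0 b0.
rewrite (ip_addl (sqint_scale c Lb) LI LZ) (ip_scalel _ Lb LZ).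
rewrite (ip_time_integral ab mH cH LH)//; congr (_ + _).
apply: eq_Rintegral => s; rewrite inE/= in_itv/= => /ge0 s0.
by rewrite /H ip_scalel//; exact: bl_sqint.
Qed.

Lemma ip_step_functional_eq0 c Z : sqint P Z ->
  (forall s, a <= s <= b -> ip P (fun w => B s w - B a w) Z = 0) ->
  ip P (step_functional a b c g) Z = 0.
Proof.
move=> LZ Z0; rewrite ip_step_functional// Z0 ?lexx ?ltW//.
rewrite (@eq_Rintegral _ _ _ mu _ (fun=> 0)).
  by rewrite Rintegral_cst// mul0r mulr0 addr0.
by move=> s; rewrite inE/= in_itv/= => /Z0 ->; rewrite mulr0.
Qed.

(** With [h = b - a], a coefficient [c] of size [h ^ 2] and a kernel [g] of
    size [h] both give a variance of size [h ^ 5], the local error that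
    corresponds to order two. *)
Lemma step_functional_var c : ip P (step_functional a b c g)
    (step_functional a b c g) <=
  2 * c ^+ 2 * (b - a) + 2 * K ^+ 2 * (b - a) ^+ 3.
Proof.
have LI := sqint_time_integral ab mH cH LH.
have Lb := sqint_scale c (bl_sqint hB a0 b0).
have VI := ip_time_integral_le ab mH cH LH.
apply: (le_trans (ip_add_le Lb LI)).
have L := bl_sqint hB a0 b0.
rewrite ip_scalel// ip_scaler// bl_cov// !subrr normr0 !subr0.
rewrite gtr0_norm ?subr_gt0//.
by move: VI; set V := ip _ _ _; lra.
Qed.

End one_step.

(** Orthogonality to every increment after time [t] is all that adaptedness
    is used for; it is a linear condition on [Z]. *)
Definition past t (Z : Omega -> R) : Prop := sqint P Z /\
  forall a s, t <= a -> a <= s -> ip P (fun w => B s w - B a w) Z = 0.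

Lemma past_le t u Z : t <= u -> past t Z -> past u Z.
Proof.
move=> tu [LZ Z0]; split=> // a s ua as_; apply: Z0 => //.
exact: le_trans ua.
Qed.

Lemma past_cst t c : 0 <= t -> past t (fun=> c).
Proof.
move=> t0; split; first exact: sqint_cst.
move=> a s ta as_; have a0 : 0 <= a by exact: le_trans ta.
have s0 : 0 <= s by exact: le_trans as_.
rewrite (_ : (fun=> c) = (fun=> c * 1)); last by rewrite mulr1.
rewrite ip_scaler ?bl_mean ?mulr0//; last exact: bl_sqint.
exact: sqint_cst.
Qed.

Lemma past_scale t c Z : 0 <= t -> past t Z -> past t (fun w => c * Z w).
Proof.
move=> t0 [LZ Z0]; split; first exact: sqint_scale.
move=> a s ta as_; have a0 : 0 <= a by exact: le_trans ta.
have s0 : 0 <= s by exact: le_trans as_.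
by rewrite (ip_scaler _ LZ (bl_sqint hB a0 s0)) Z0// mulr0.
Qed.

Lemma past_add t Z Z' : 0 <= t -> past t Z -> past t Z' ->
  past t (fun w => Z w + Z' w).
Proof.
move=> t0 [LZ Z0] [LZ' Z'0]; split; first exact: sqint_add.
move=> a s ta as_; have a0 : 0 <= a by exact: le_trans ta.
have s0 : 0 <= s by exact: le_trans as_.
by rewrite (ip_addr LZ LZ' (bl_sqint hB a0 s0)) Z0// Z'0// addr0.
Qed.

Lemma past_step_functional a b c g K : 0 <= a -> a < b -> continuous g ->
  (forall s, a <= s <= b -> `|g s| <= K) -> past b (step_functional a b c g).
Proof.
move=> a0 ab cg gK; split; first exact: sqint_step_functional a0 ab cg gK c.
move=> u s bu us; have u0 : 0 <= u by rewrite (le_trans _ bu)// (le_trans a0)// ltW.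
have s0 : 0 <= s by exact: le_trans us.
rewrite ipC (ip_step_functional_eq0 a0 ab cg gK)//; first exact: bl_sqint.
move=> t /andP[at_ tb]; have t0 : 0 <= t by exact: le_trans at_.
rewrite bl_cov//.
rewrite ger0_norm ?subr_ge0; last by rewrite (le_trans at_)// (le_trans tb)// (le_trans bu).
rewrite ler0_norm ?subr_le0; last by rewrite (le_trans tb).
rewrite ger0_norm ?subr_ge0; last by rewrite (le_trans tb)// (le_trans bu).
rewrite ger0_norm ?subr_ge0; last by rewrite (le_trans at_)// (le_trans tb).
lra.
Qed.

Lemma ip_step_functional_past a b c g K Z : 0 <= a -> a < b -> continuous g ->
  (forall s, a <= s <= b -> `|g s| <= K) -> past a Z ->
  ip P (step_functional a b c g) Z = 0.
Proof.
move=> a0 ab cg gK [LZ Z0]; apply: (ip_step_functional_eq0 a0 ab cg gK) => //.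
by move=> s /andP[as_ _]; exact: Z0.
Qed.

Lemma step_functional_sub a b c c' g g' w : a < b ->
  continuous g -> continuous g' ->
  step_functional a b c g w - step_functional a b c' g' w =
  step_functional a b (c - c') (fun s => g s - g' s) w.
Proof.
move=> ab cg cg'; rewrite /step_functional.
have cD g1 : continuous g1 -> mu.-integrable `[a, b]
    (EFin \o (fun s => g1 s * (B s w - B a w))).
  move=> cg1; apply: continuous_integrable_itv => s; apply: cvgM; first exact: cg1.
  by apply: cvgB; [exact: bl_continuous|exact: cvg_cst].
under [in RHS]eq_Rintegral => s _ do rewrite mulrBl.
by rewrite RintegralB//; [ring|exact: cD|exact: cD].
Qed.

(** The classical values [E I ^ 2 = h], [E (I * I10) = h ^ 2 / 2] and
    [E I10 ^ 2 = h ^ 3 / 3], for the combination [c * I + r * I10]. *)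
Lemma step_functional_cst_var a b c r : 0 <= a -> a < b ->
  ip P (step_functional a b c (fun=> r)) (step_functional a b c (fun=> r)) =
  c ^+ 2 * (b - a) + c * r * (b - a) ^+ 2 + r ^+ 2 * (b - a) ^+ 3 / 3.
Proof.
move=> a0 ab; have b0 : 0 <= b by rewrite (le_trans a0)// ltW.
have cr : continuous (fun _ : R => r) by move=> x; exact: cvg_cst.
have rK s : a <= s <= b -> `|r| <= `|r| by [].
set Z := step_functional a b c (fun=> r).
have LZ : sqint P Z by exact: (sqint_step_functional a0 ab cr rK).
have EZ s : a <= s <= b -> ip P (fun w => B s w - B a w) Z =
    c * (s - a) + r * ((s - a) * (b - a) - (s - a) ^+ 2 / 2).
  move=> /andP[as_ sb]; have s0 : 0 <= s by exact: le_trans as_.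
  rewrite ipC (ip_step_functional a0 ab cr rK); last exact: bl_sqint.
  have cov t : a <= t -> ip P (fun w => B t w - B a w) (fun w => B s w - B a w)
      = (t - a + (s - a) - `|t - s|) / 2.
    move=> at_; have t0 : 0 <= t by exact: le_trans at_.
    rewrite bl_cov// subrr normr0 (distrC s t).
    by rewrite [`|s - a|]ger0_norm ?[`|t - a|]ger0_norm ?subr_ge0//; field.
  rewrite cov; last exact: ltW.
  rewrite (@eq_Rintegral _ _ _ mu _
      (fun t => r * ((t - a + (s - a) - `|t - s|) / 2))); last first.
    by move=> t; rewrite inE/= in_itv/= => /andP[at_ _]; rewrite cov.
  rewrite (Rintegral_split as_ sb); last first.
    move=> t; apply: cvgM; first exact: cvg_cst.
    apply: cvgM; last exact: cvg_cst.
    apply: cvgB.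
      by apply: cvgD; [apply: cvgB; [exact: cvg_id|exact: cvg_cst]|exact: cvg_cst].
    apply: cvg_norm; apply: cvgB; [exact: cvg_id|exact: cvg_cst].
  rewrite (@eq_Rintegral _ _ _ mu _
      (fun t => 0 + r * (t - a) + 0 * (t - a) ^+ 2)); last first.
    move=> t; rewrite inE/= in_itv/= => /andP[_ ts].
    by rewrite ler0_norm ?subr_le0//; field.
  rewrite Rintegral_quadratic//.
  rewrite (@eq_Rintegral _ _ _ mu _
      (fun t => r * (s - a) + 0 * (t - s) + 0 * (t - s) ^+ 2)); last first.
    move=> t; rewrite inE/= in_itv/= => /andP[st _].
    by rewrite ger0_norm ?subr_ge0//; field.
  rewrite Rintegral_quadratic// ger0_norm ?subr_ge0//.
  by field.
rewrite (ip_step_functional a0 ab cr rK)// EZ ?lexx ?ltW//.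
rewrite (@eq_Rintegral _ _ _ mu _ (fun s => 0 +
    (r * c + r ^+ 2 * (b - a)) * (s - a) + - (r ^+ 2 / 2) * (s - a) ^+ 2)).
  by rewrite Rintegral_quadratic ?ltW//; field.
by move=> s; rewrite inE/= in_itv/= => /EZ ->; field.
Qed.

End brownian.
(** * Taylor bounds for sine and cosine *)

Section trigonometric_bounds.
Context {R : realType}.
Implicit Types (f F : R -> R) (x : R).

Lemma le_is_derive f F x : 0 <= x -> continuous f ->
  (forall t : R, is_derive t (1 : R) F (f t)) ->
  (forall t, 0 <= t -> 0 <= f t) -> F 0 <= F x.
Proof.
move=> x0 cf dF f0; rewrite -subr_ge0 -(Rintegral_is_derive x0 cf dF).
by apply: Rintegral_ge0 => t; rewrite /= in_itv/= => /andP[+ _]; exact: f0.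
Qed.

Let d2 (t : R) := is_derive_mul (is_derive_id_fun t) (is_derive_id_fun t).

(** Each of the four bounds follows by integrating the previous one, starting
    from [cos t <= 1]. *)
Lemma sin_le_id x : 0 <= x -> sin x <= x.
Proof.
move=> x0.
have cf : continuous (fun t : R => 1 - cos t).
  by move=> t; apply: cvgB; [exact: cvg_cst|exact: continuous_cos].
have dF (t : R) : is_derive t (1 : R) (fun t => t - sin t) (1 - cos t).
  exact: is_derive_add (is_derive_id_fun t) (is_derive_opp (is_derive_sin t)).
have := le_is_derive x0 cf dF.
rewrite sin0 subr0 subr_ge0; apply=> t _.
by rewrite subr_ge0 cos_le1.
Qed.

Lemma cos_ge_quadratic x : 0 <= x -> 1 - x ^+ 2 / 2 <= cos x.
Proof.
move=> x0.
have cf : continuous (fun t : R => t - sin t).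
  by move=> t; apply: cvgB; [exact: cvg_id|exact: continuous_sin].
have dF (t : R) : is_derive t (1 : R) (fun t => cos t + 2^-1 * (t * t))
    (t - sin t).
  apply: (is_derive_eq (is_derive_add (is_derive_cos t)
    (is_derive_mul (is_derive_cst_fun 2^-1 t) (d2 t)))).
  by rewrite /=; field.
have := le_is_derive x0 cf dF; rewrite cos0.
suff f0 (t : R) : 0 <= t -> 0 <= t - sin t by move=> /(_ f0); lra.
by move=> t0; rewrite subr_ge0 sin_le_id.
Qed.

Lemma sin_ge_cubic x : 0 <= x -> x - x ^+ 3 / 6 <= sin x.
Proof.
move=> x0.
have cf : continuous (fun t : R => cos t - 1 + 2^-1 * (t * t)).
  move=> t; apply: cvgD.
    by apply: cvgB; [exact: continuous_cos|exact: cvg_cst].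
  by apply: cvgM; [exact: cvg_cst|apply: cvgM; exact: cvg_id].
have dF (t : R) : is_derive t (1 : R)
    (fun t => sin t - t + 6^-1 * (t * (t * t))) (cos t - 1 + 2^-1 * (t * t)).
  apply: (is_derive_eq (is_derive_add
    (is_derive_add (is_derive_sin t) (is_derive_opp (is_derive_id_fun t)))
    (is_derive_mul (is_derive_cst_fun 6^-1 t)
      (is_derive_mul (is_derive_id_fun t) (d2 t))))).
  by rewrite /=; field.
have := le_is_derive x0 cf dF; rewrite sin0.
suff f0 (t : R) : 0 <= t -> 0 <= cos t - 1 + 2^-1 * (t * t) by move=> /(_ f0); lra.
by move=> t0; have := cos_ge_quadratic t0; lra.
Qed.

Lemma cos_le_quartic x : 0 <= x -> cos x <= 1 - x ^+ 2 / 2 + x ^+ 4 / 24.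
Proof.
move=> x0.
have cf : continuous (fun t : R => sin t - t + 6^-1 * (t * (t * t))).
  move=> t; apply: cvgD.
    by apply: cvgB; [exact: continuous_sin|exact: cvg_id].
  by apply: cvgM; [exact: cvg_cst|do !apply: cvgM; exact: cvg_id].
have dF (t : R) : is_derive t (1 : R)
    (fun t => - cos t - 2^-1 * (t * t) + 24^-1 * ((t * t) * (t * t)))
    (sin t - t + 6^-1 * (t * (t * t))).
  apply: (is_derive_eq (is_derive_add
    (is_derive_add (is_derive_opp (is_derive_cos t))
      (is_derive_opp (is_derive_mul (is_derive_cst_fun 2^-1 t) (d2 t))))
    (is_derive_mul (is_derive_cst_fun 24^-1 t)
      (is_derive_mul (d2 t) (d2 t))))).
  by rewrite /=; field.
have := le_is_derive x0 cf dF; rewrite cos0.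
suff f0 (t : R) : 0 <= t -> 0 <= sin t - t + 6^-1 * (t * (t * t)).
  by move=> /(_ f0); lra.
by move=> t0; have := sin_ge_cubic t0; lra.
Qed.

Lemma cos_sin_near (a b u : R) : 0 <= a -> b - a <= 1 -> a <= u <= b ->
  `|sin (b - u)| <= b - a /\ `|cos (b - u) - 1| <= b - a.
Proof.
move=> a0 ba1 /andP[au ub].
have x0 : 0 <= b - u by rewrite subr_ge0.
have xh : b - u <= b - a by rewrite lerD2l lerN2.
have x1 : b - u <= 1 by exact: le_trans ba1.
move: x0 xh x1; move: (b - u) (b - a) => x k x0 xk x1.
have s1 := sin_le_id x0; have s2 := sin_ge_cubic x0.
have c1 := cos_ge_quadratic x0; have c2 := cos_le1 x.
have x2 : x ^+ 2 <= x by rewrite expr2 ler_piMl.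
have x3 : x ^+ 3 <= x by rewrite exprS ler_piMr// expr_le1.
by rewrite !ler_norml; split; apply/andP; split; lra.
Qed.

End trigonometric_bounds.

(** * One step of the scheme *)

(** With [c = h / 4], a step multiplies by the square of the Cayley factor
    [m = (1 + i * c) / (1 - i * c) = 1 + (u + i * v)]. The noise of a
    step is [(1 + (m - 1) ^ 2 * b1) * I + (m - 1) * (m * d1 + d2) * I10 / h];
    [nI1], [nI2] and [nJ1], [nJ2] are the real and imaginary parts of the
    coefficients of [I] and [I10], and [rot1], [rot2] those of [m ^ 2]. *)
Section scheme.
Context {R : realType}.
Implicit Types (h sigma I J s : R).

Definition cay_u h : R := - 2 * (h / 4) ^+ 2 / (1 + (h / 4) ^+ 2).
Definition cay_v h : R := 2 * (h / 4) / (1 + (h / 4) ^+ 2).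
Definition rot1 h : R := (1 + cay_u h) ^+ 2 - cay_v h ^+ 2.
Definition rot2 h : R := 2 * (1 + cay_u h) * cay_v h.
Definition nI1 (b1 : R) h : R := 1 + (cay_u h ^+ 2 - cay_v h ^+ 2) * b1.
Definition nI2 (b1 : R) h : R := 2 * cay_u h * cay_v h * b1.
Definition nJ1 (d1 d2 : R) h : R :=
  (cay_u h * ((1 + cay_u h) * d1 + d2) - cay_v h ^+ 2 * d1) / h.
Definition nJ2 (d1 d2 : R) h : R :=
  (cay_u h * cay_v h * d1 + cay_v h * ((1 + cay_u h) * d1 + d2)) / h.

Lemma cayD_gt0 h : 0 < 1 + (h / 4) ^+ 2.
Proof. by rewrite ltr_wpDr// sqr_ge0. Qed.

Lemma rot_unit h : rot1 h ^+ 2 + rot2 h ^+ 2 = 1.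
Proof.
have := cayD_gt0 h; rewrite /rot1 /rot2 /cay_u /cay_v.
by move: (h / 4) => c D0; field; rewrite gt_eqF.
Qed.

Lemma stage_solve (c p q x z : R) : x = p - c * z -> z = q + c * x ->
  x = (p - c * q) / (1 + c ^+ 2) /\ z = (q + c * p) / (1 + c ^+ 2).
Proof.
move=> ex ez; have D0 : 0 < 1 + c ^+ 2 by rewrite ltr_wpDr// sqr_ge0.
have -> : p = x + c * z by rewrite {1}ex subrK.
have -> : q = z - c * x by rewrite {1}ez addrK.
by split; field; rewrite gt_eqF.
Qed.

Lemma ssrk_stepE (b1 : R) h sigma I J (y y' : R^o * R^o) : h != 0 ->
  ssrk_step b1 h sigma I J y y' ->
  let d1 := ssrk_d1 b1 in let d2 := ssrk_d2 b1 in
  y'.1 = rot1 h * y.1 - rot2 h * y.2 + sigma * (nI1 b1 h * I + nJ1 d1 d2 h * J) /\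
  y'.2 = rot2 h * y.1 + rot1 h * y.2 + sigma * (nI2 b1 h * I + nJ2 d1 d2 h * J).
Proof.
move=> h0 [[Y11 Y12] [[Y21 Y22] [E1 E2 E3]]] d1 d2.
have := congr1 fst E1; have := congr1 snd E1; have := congr1 fst E2.
have := congr1 snd E2; have := congr1 fst E3; have := congr1 snd E3.
rewrite -/d1 -/d2 /sho_drift /sho_noise /=.
case: y y' {E1 E2 E3} => [y1 y2] [z1 z2] /=; rewrite /GRing.scale /= => -> -> .
move: d1 d2 => d1 d2 e22 e21 e12 e11.
set a := b1 * I + d1 * (J / h); set a' := - b1 * I + d2 * (J / h).
pose c := h / 4.
have [E11 E12] : Y11 = (y1 + a * sigma - c * y2) / (1 + c ^+ 2) /\
    Y12 = (y2 + c * (y1 + a * sigma)) / (1 + c ^+ 2).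
  by apply: stage_solve; [rewrite e11 /c /a; ring|rewrite e12 /c; ring].
have [E21 E22] : Y21 = (y1 - 2 * c * Y12 + a' * sigma - c * (y2 + 2 * c * Y11))
      / (1 + c ^+ 2) /\
    Y22 = (y2 + 2 * c * Y11 + c * (y1 - 2 * c * Y12 + a' * sigma))
      / (1 + c ^+ 2).
  by apply: stage_solve; [rewrite e21 /c /a'; field|rewrite e22 /c; field].
have D0 := cayD_gt0 h; rewrite -/c in D0.
have hE : h = 4 * c by rewrite /c; field.
have c0 : c != 0 by rewrite /c mulf_neq0.
rewrite E21 E22 E11 E12 /rot1 /rot2 /nI1 /nI2 /nJ1 /nJ2 /cay_u /cay_v -/c.
rewrite /a /a' hE; clearbody c.
by split; field; rewrite c0 gt_eqF.
Qed.

End scheme.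
(** * The coefficients for the two values of b1 *)

(** The two cases are treated together: [s] is either square root of [6]. *)
Section coefficients.
Context {R : realType}.
Variables (s : R) (s6 : s ^+ 2 = 6).
Implicit Types (h : R).
Local Notation b1 := ((- 2 + s) / 6).
Local Notation d1 := (1 - s / 3).
Local Notation d2 := (1 + s / 3).

Lemma root6_bound : - 3 <= s <= 3.
Proof.
have := sqr_ge0 (s - 3); have := sqr_ge0 (s + 3).
rewrite sqrrB sqrrD s6 => ? ?; apply/andP; split; lra.
Qed.

Let sqrtE : Num.sqrt (2 - 3 * b1 ^+ 2) = 1 + s / 6.
Proof.
have -> : 2 - 3 * b1 ^+ 2 = (1 + s / 6) ^+ 2.
  have -> : 2 - 3 * b1 ^+ 2 = (1 + s / 6) ^+ 2 - (s ^+ 2 - 6) / 9 by field.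
  by rewrite s6 subrr mul0r subr0.
by rewrite sqrtr_sqr ger0_norm//; have := root6_bound; lra.
Qed.

Lemma ssrk_d1E : ssrk_d1 b1 = d1.
Proof. by rewrite /ssrk_d1 sqrtE; field. Qed.

Lemma ssrk_d2E : ssrk_d2 b1 = d2.
Proof. by rewrite /ssrk_d2 sqrtE; field. Qed.

(** With [w = m - 1], the variance exceeds [h] by
    [h * |w| ^ 4 * (s ^ 2 - 6) / 108], which vanishes because [s ^ 2 = 6]. *)
Lemma noise_variance h : h != 0 ->
  (nI1 b1 h ^+ 2 + nI2 b1 h ^+ 2) * h +
  (nI1 b1 h * nJ1 d1 d2 h + nI2 b1 h * nJ2 d1 d2 h) * h ^+ 2 +
  (nJ1 d1 d2 h ^+ 2 + nJ2 d1 d2 h ^+ 2) * h ^+ 3 / 3 = h.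
Proof.
move=> h0.
transitivity (h + h * (cay_u h ^+ 2 + cay_v h ^+ 2) ^+ 2 / 108 * (s ^+ 2 - 6)).
  rewrite /nI1 /nI2 /nJ1 /nJ2 /cay_u /cay_v; have D0 := cayD_gt0 h.
  pose c := h / 4; have hE : h = 4 * c by rewrite /c; field.
  have c0 : c != 0 by rewrite /c mulf_neq0.
  rewrite -/c in D0 *; clearbody c; rewrite hE.
  by field; rewrite c0 gt_eqF.
by rewrite s6 subrr mulr0 addr0.
Qed.

Section small_step.
Variables (h : R) (h0 : 0 < h) (h1 : h <= 1).

Let D0 := cayD_gt0 h.

Let invD : 1 - (h / 4) ^+ 2 <= (1 + (h / 4) ^+ 2)^-1 <= 1.
Proof.
apply/andP; split; last by rewrite invf_le1// lerDl sqr_ge0.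
rewrite -[leRHS]mul1r ler_pdivlMr//; nra.
Qed.

Let uE : cay_u h = - (h ^+ 2 / 8) * (1 + (h / 4) ^+ 2)^-1.
Proof. by rewrite /cay_u; congr (_ * _); field. Qed.

Let vE : cay_v h = h / 2 * (1 + (h / 4) ^+ 2)^-1.
Proof. by rewrite /cay_v; congr (_ * _); field. Qed.

Let u_bound : - (h ^+ 2 / 8) <= cay_u h <= 0.
Proof.
have /andP[_ r1] := invD; have r0 : 0 <= (1 + (h / 4) ^+ 2)^-1.
  by rewrite invr_ge0 ltW.
have a0 : 0 <= h ^+ 2 / 8 by rewrite divr_ge0 ?sqr_ge0.
by rewrite uE mulNr lerN2 oppr_le0 ler_piMr//= mulr_ge0.
Qed.

Let v_bound : 0 <= cay_v h <= h / 2.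
Proof.
have /andP[_ r1] := invD; have r0 : 0 <= (1 + (h / 4) ^+ 2)^-1.
  by rewrite invr_ge0 ltW.
have a0 : 0 <= h / 2 by rewrite divr_ge0 ?ltW.
by rewrite vE ler_piMr// andbT mulr_ge0.
Qed.

Let nu : `|cay_u h| <= h ^+ 2 / 8.
Proof. by rewrite ler_norml; have := u_bound; have := sqr_ge0 h; lra. Qed.

Let nv : `|cay_v h| <= h / 2.
Proof. by rewrite ler_norml; have := v_bound; lra. Qed.

Let nb : `|b1| <= 1.
Proof. by rewrite ler_norml; have := root6_bound; lra. Qed.

Let nd : `|d1| <= 2.
Proof. by rewrite ler_norml; have := root6_bound; lra. Qed.

Let normM_le (x y a b : R) : `|x| <= a -> `|y| <= b -> `|x * y| <= a * b.
Proof. by move=> xa yb; rewrite normrM ler_pM. Qed.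

Let normD_le (x y a b : R) : `|x| <= a -> `|y| <= b -> `|x + y| <= a + b.
Proof. by move=> xa yb; rewrite (le_trans (ler_normD _ _))// lerD. Qed.

Let normB_le (x y a b : R) : `|x| <= a -> `|y| <= b -> `|x - y| <= a + b.
Proof. by move=> xa yb; rewrite (le_trans (ler_normB _ _))// lerD. Qed.

Let h2 : h ^+ 2 <= h.
Proof. by rewrite expr2 ger_pMr. Qed.

Let h4 : h ^+ 4 <= h ^+ 3.
Proof. by rewrite exprS ler_piMl// exprn_ge0// ltW. Qed.

Let h32 : h ^+ 3 <= h ^+ 2.
Proof. by rewrite exprS ler_piMl// exprn_ge0// ltW. Qed.

Let h20 : 0 <= h ^+ 2. Proof. exact: sqr_ge0. Qed.

Let h30 : 0 <= h ^+ 3. Proof. by rewrite exprn_ge0// ltW. Qed.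

Lemma nI1_bound : `|nI1 b1 h - 1| <= h ^+ 2.
Proof.
rewrite /nI1 addrAC subrr add0r !expr2.
apply: (le_trans (normM_le (normB_le (normM_le nu nu) (normM_le nv nv)) nb)).
move: h4 h32 h20 h30; lra.
Qed.

Lemma nI2_bound : `|nI2 b1 h| <= h ^+ 2.
Proof.
rewrite /nI2 -2!mulrA.
have n2 : `|2 : R| <= 2 by rewrite ger0_norm.
apply: (le_trans (normM_le n2 (normM_le nu (normM_le nv nb)))).
move: h4 h32 h20 h30; lra.
Qed.

Lemma nJ1_bound : `|nJ1 d1 d2 h| <= h.
Proof.
have -> : nJ1 d1 d2 h =
    (cay_u h * (2 + cay_u h * d1) - cay_v h * cay_v h * d1) / h.
  by rewrite /nJ1; field; rewrite gt_eqF.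
have n2 : `|2 : R| <= 2 by rewrite ger0_norm.
rewrite normrM normfV (gtr0_norm h0) ler_pdivrMr//.
apply: (le_trans (normB_le (normM_le nu (normD_le n2 (normM_le nu nd)))
  (normM_le (normM_le nv nv) nd))).
move: h4 h32 h20 h30; lra.
Qed.

Lemma nJ2_bound : `|nJ2 d1 d2 h - 1| <= h.
Proof.
set r := (1 + (h / 4) ^+ 2)^-1.
have -> : nJ2 d1 d2 h - 1 = (r - 1) + cay_u h * (r * d1).
  by rewrite /nJ2 vE -/r; field; rewrite gt_eqF.
have /andP[r1 r2] := invD; rewrite -/r in r1 r2.
have nr1 : `|r - 1| <= h ^+ 2 / 16 by rewrite ler_norml; move: h20; lra.
have nr : `|r| <= 1.
  by rewrite ger0_norm// invr_ge0 ltW.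
apply: (le_trans (normD_le nr1 (normM_le nu (normM_le nr nd)))).
move: h2 h20; lra.
Qed.

Lemma rot1_bound : `|rot1 h - cos h| <= h ^+ 3.
Proof.
have hh := ltW h0; have c1 := cos_ge_quadratic hh; have c2 := cos_le_quartic hh.
set r := (1 + (h / 4) ^+ 2)^-1.
have E : rot1 h = 1 - h ^+ 2 / 2 + (h ^+ 4 / 16 + h ^+ 6 / 512) * r ^+ 2.
  rewrite /rot1 /cay_u /cay_v /r; move: D0.
  pose c := h / 4; have -> : h = 4 * c by rewrite /c; field.
  have -> : 4 * c / 4 = c by field.
  by move=> Dc; field; rewrite gt_eqF.
have /andP[_ r1] := invD; have r0 : 0 <= r by rewrite invr_ge0 ltW.
have r2 : r ^+ 2 <= 1 by rewrite expr_le1.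
have h6 : h ^+ 6 <= h ^+ 4.
  by rewrite (exprD h 2 4) ler_piMl ?exprn_ge0// expr_le1.
have h40 : 0 <= h ^+ 4 by rewrite exprn_ge0.
have h60 : 0 <= h ^+ 6 by rewrite exprn_ge0.
have q0 : 0 <= h ^+ 4 / 16 + h ^+ 6 / 512 by rewrite addr_ge0 ?divr_ge0 ?ler0n.
have p0 : 0 <= (h ^+ 4 / 16 + h ^+ 6 / 512) * r ^+ 2.
  by rewrite mulr_ge0 ?sqr_ge0.
have p1 : (h ^+ 4 / 16 + h ^+ 6 / 512) * r ^+ 2 <= h ^+ 4 / 16 + h ^+ 6 / 512.
  by rewrite ler_piMr.
rewrite E ler_norml; move: h4 p0 p1.
by set p := _ * r ^+ 2 => ? ? ?; apply/andP; split; lra.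
Qed.

Lemma rot2_bound : `|rot2 h - sin h| <= h ^+ 3.
Proof.
have hh := ltW h0; have c1 := sin_le_id hh; have c2 := sin_ge_cubic hh.
set r := (1 + (h / 4) ^+ 2)^-1.
have E : rot2 h = h - (3 * h ^+ 3 / 16 + h ^+ 5 / 256) * r ^+ 2.
  rewrite /rot2 /cay_u /cay_v /r; move: D0.
  pose c := h / 4; have -> : h = 4 * c by rewrite /c; field.
  have -> : 4 * c / 4 = c by field.
  by move=> Dc; field; rewrite gt_eqF.
have /andP[_ r1] := invD; have r0 : 0 <= r by rewrite invr_ge0 ltW.
have r2 : r ^+ 2 <= 1 by rewrite expr_le1.
have h5 : h ^+ 5 <= h ^+ 3.
  by rewrite (exprD h 2 3) ler_piMl ?exprn_ge0// expr_le1.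
have h50 : 0 <= h ^+ 5 by rewrite exprn_ge0.
have q0 : 0 <= 3 * h ^+ 3 / 16 + h ^+ 5 / 256.
  by rewrite addr_ge0 ?divr_ge0 ?mulr_ge0 ?ler0n.
have p0 : 0 <= (3 * h ^+ 3 / 16 + h ^+ 5 / 256) * r ^+ 2.
  by rewrite mulr_ge0 ?sqr_ge0.
have p1 : (3 * h ^+ 3 / 16 + h ^+ 5 / 256) * r ^+ 2 <=
    3 * h ^+ 3 / 16 + h ^+ 5 / 256.
  by rewrite ler_piMr.
rewrite E ler_norml; move: h30 p0 p1.
by set p := _ * r ^+ 2 => ? ? ?; apply/andP; split; lra.
Qed.

End small_step.

End coefficients.
(** * One step of the exact solution *)

Section exact_solution.
Context {R : realType}.
Local Notation mu := (@lebesgue_measure R).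
Implicit Types (f p q : R -> R) (a b t : R).

Lemma is_derive_parameterized_integral f t : continuous f -> 0 < t ->
  is_derive t (1 : R) (fun x => \int[mu]_(s in `[0, x]) f s) (f t).
Proof.
move=> cf t0; have tt : t < t + 1 by rewrite ltrDl.
have [D1 D2] := continuous_FTC1_closed tt
  (@continuous_integrable_itv R f 0 (t + 1) cf) t0 (cf t).
by rewrite derive1E in D2; exact: DeriveDef D1 D2.
Qed.

(** [F] will be an integral from [0], which is differentiable at positive times
    only; continuity up to the end points is borrowed from [G]. *)
Lemma Rintegral_FTC2_near (F G f : R -> R) a b : a < b -> continuous f ->
  continuous G -> (forall t, a <= t -> F t = G t) ->
  (forall t : R, a < t -> is_derive t (1 : R) F (f t)) ->
  \int[mu]_(s in `[a, b]) f s = G b - G a.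
Proof.
move=> ab cf cG FG dF.
rewrite /Rintegral (@continuous_FTC2 R f F)//.
- by rewrite !FG// ltW.
- exact: continuous_subspaceT.
- split.
  + by move=> t; rewrite in_itv/= => /andP[at_ _]; case: (dF t at_).
  + rewrite FG//; apply: (@cvg_trans _ (G x @[x --> a^'+])).
      by apply: near_eq_cvg; apply: filterS (nbhs_right_ge a) => x /FG ->.
    exact/cvg_at_right_filter/cG.
  + rewrite FG ?ltW//; apply: (@cvg_trans _ (G x @[x --> b^'-])).
      by apply: near_eq_cvg; apply: filterS (nbhs_left_gt ab) => x /ltW/FG ->.
    exact/cvg_at_left_filter/cG.
- move=> t; rewrite in_itv/= => /andP[at_ _].
  by rewrite derive1E; case: (dF t at_).
Qed.

(** Variation of constants along one path: subtracting the noise makes the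
    momentum differentiable, and rotating back by [b - s] removes the linear
    part of the equation. *)
Lemma sho_path_step (p q B : R -> R) (sigma p0 q0 a b : R) :
  continuous p -> continuous q -> continuous B ->
  (forall t, 0 <= t -> p t = p0 + \int[mu]_(s in `[0, t]) (- q s)
                             + sigma * (B t - B 0)) ->
  (forall t, 0 <= t -> q t = q0 + \int[mu]_(s in `[0, t]) p s) ->
  0 <= a -> a < b ->
  p b = cos (b - a) * p a - sin (b - a) * q a + sigma * (1 * (B b - B a) +
    \int[mu]_(s in `[a, b]) (- sin (b - s) * (B s - B a))) /\
  q b = sin (b - a) * p a + cos (b - a) * q a + sigma * (0 * (B b - B a) +
    \int[mu]_(s in `[a, b]) (cos (b - s) * (B s - B a))).
Proof.
move=> cp cq cB Ep Eq a0 ab.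
pose u t := p t - sigma * (B t - B a).
pose u' t := p0 + sigma * (B a - B 0) + \int[mu]_(s in `[0, t]) (- q s).
pose q' t := q0 + \int[mu]_(s in `[0, t]) p s.
have cNq : continuous (fun s => - q s) by move=> t; apply: cvgN; exact: cq.
have ge0 t : a <= t -> 0 <= t by exact: le_trans.
have Eu t : a <= t -> u' t = u t.
  by move=> /ge0 t0; rewrite /u /u' Ep//; ring.
have Eq' t : a <= t -> q' t = q t by move=> /ge0 t0; rewrite /q' Eq.
have cBa : continuous (fun s => B s - B a).
  by move=> t; apply: cvgB; [exact: cB|exact: cvg_cst].
have cu : continuous u.
  move=> t; apply: cvgB; first exact: cp.
  by apply: cvgM; [exact: cvg_cst|exact: cBa].
have csub : continuous (fun s : R => b - s).
  by move=> t; apply: cvgB; [exact: cvg_cst|exact: cvg_id].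
have csin : continuous (fun s : R => sin (b - s)).
  by move=> t; apply: (cvg_comp (fun s : R => b - s) sin (csub t)); exact: continuous_sin.
have ccos : continuous (fun s : R => cos (b - s)).
  by move=> t; apply: (cvg_comp (fun s : R => b - s) cos (csub t)); exact: continuous_cos.
have du t : a < t -> is_derive t (1 : R) u' (- q t).
  move=> at_; have t0 : 0 < t by exact: le_lt_trans at_.
  apply: (is_derive_eq (is_derive_add (is_derive_cst_fun _ t)
    (is_derive_parameterized_integral cNq t0))).
  by rewrite add0r.
have dq t : a < t -> is_derive t (1 : R) q' (p t).
  move=> at_; have t0 : 0 < t by exact: le_lt_trans at_.
  apply: (is_derive_eq (is_derive_add (is_derive_cst_fun _ t)
    (is_derive_parameterized_integral cp t0))).
  by rewrite add0r.
have dsub (t : R) := is_derive_add (is_derive_cst_fun b t)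
  (is_derive_opp (is_derive_id_fun t)).
have dcos t := @is_derive_chain _ cos (fun y => b - y) _ _ _ (is_derive_cos (b - t))
  (dsub t).
have dsin t := @is_derive_chain _ sin (fun y => b - y) _ _ _ (is_derive_sin (b - t))
  (dsub t).
split.
- pose F t := cos (b - t) * u' t + - (sin (b - t) * q' t).
  pose G t := cos (b - t) * u t + - (sin (b - t) * q t).
  have FG t : a <= t -> F t = G t by move=> at_; rewrite /F /G Eu// Eq'.
  have cG : continuous G.
    move=> t; apply: cvgB; apply: cvgM; [exact: ccos|exact: cu|exact: csin|exact: cq].
  have cf : continuous (fun s => sigma * (- sin (b - s) * (B s - B a))).
    move=> t; apply: cvgM; first exact: cvg_cst.
    by apply: cvgM; [apply: cvgN; exact: csin|exact: cBa].
  have dF (t : R) : a < t ->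
      is_derive t (1 : R) F (sigma * (- sin (b - t) * (B t - B a))).
    move=> at_; apply: (is_derive_eq (is_derive_add
      (is_derive_mul (dcos t) (du t at_))
      (is_derive_opp (is_derive_mul (dsin t) (dq t at_))))).
    by rewrite /= Eu ?ltW// Eq' ?ltW// /u; ring.
  have := Rintegral_FTC2_near ab cf cG FG dF.
  rewrite RintegralZl//; last first.
    by apply: continuous_integrable_itv => t; apply: cvgM;
      [apply: cvgN; exact: csin|exact: cBa].
  rewrite /G /u subrr cos0 sin0 subrr mulr0 subr0 => E.
  rewrite mulrDr E; ring.
- pose F t := sin (b - t) * u' t + cos (b - t) * q' t.
  pose G t := sin (b - t) * u t + cos (b - t) * q t.
  have FG t : a <= t -> F t = G t by move=> at_; rewrite /F /G Eu// Eq'.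
  have cG : continuous G.
    move=> t; apply: cvgD; apply: cvgM; [exact: csin|exact: cu|exact: ccos|exact: cq].
  have cf : continuous (fun s => sigma * (cos (b - s) * (B s - B a))).
    move=> t; apply: cvgM; first exact: cvg_cst.
    by apply: cvgM; [exact: ccos|exact: cBa].
  have dF (t : R) : a < t ->
      is_derive t (1 : R) F (sigma * (cos (b - t) * (B t - B a))).
    move=> at_; apply: (is_derive_eq (is_derive_add
      (is_derive_mul (dsin t) (du t at_))
      (is_derive_mul (dcos t) (dq t at_)))).
    by rewrite /= Eu ?ltW// Eq' ?ltW// /u; ring.
  have := Rintegral_FTC2_near ab cf cG FG dF.
  rewrite RintegralZl//; last first.
    by apply: continuous_integrable_itv => t; apply: cvgM;
      [exact: ccos|exact: cBa].
  rewrite /G /u subrr cos0 sin0 subrr mulr0 subr0 => E.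
  rewrite mulrDr E; ring.
Qed.

End exact_solution.
(** * Rotations, Young's inequality and Gronwall's inequality *)

Section ip_geometry.
Context d (Omega : measurableType d) (R : realType) (P : probability Omega R).
Implicit Types (f g : Omega -> R) (c e r : R).

Lemma ip_rotation c e f g : sqint P f -> sqint P g ->
  ip P (fun w => c * f w - e * g w) (fun w => c * f w - e * g w) +
  ip P (fun w => e * f w + c * g w) (fun w => e * f w + c * g w) =
  (c ^+ 2 + e ^+ 2) * (ip P f f + ip P g g).
Proof.
move=> Lf Lg; have Lcf := sqint_scale c Lf; have Leg := sqint_scale e Lg.
have Lef := sqint_scale e Lf; have Lcg := sqint_scale c Lg.
have LNeg := sqint_opp Leg.
rewrite (ip_add_sqr Lcf LNeg) (ip_add_sqr Lef Lcg).
have Z a b f1 g1 : sqint P f1 -> sqint P g1 ->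
    ip P (fun w => a * f1 w) (fun w => b * g1 w) = a * b * ip P f1 g1.
  move=> L1 L2; rewrite (ip_scalel _ L1 (sqint_scale b L2)).
  by rewrite (ip_scaler _ L2 L1) mulrA.
have -> : (fun w => - (e * g w)) = (fun w => - e * g w).
  by apply/funext => w; rewrite mulNr.
rewrite !Z//; ring.
Qed.

Lemma ip_young r f g : 0 < r -> sqint P f -> sqint P g ->
  ip P (fun w => f w + g w) (fun w => f w + g w) <=
  (1 + r) * ip P f f + (1 + r^-1) * ip P g g.
Proof.
move=> r0 Lf Lg; rewrite ip_add_sqr//.
have Lrf := sqint_scale r Lf; have LNg := sqint_opp Lg.
have := ip_ge0 P (fun w => r * f w + - g w); rewrite (ip_add_sqr Lrf LNg).
have -> : (fun w => - g w) = (fun w => -1 * g w).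
  by apply/funext => w; rewrite mulN1r.
rewrite !(ip_scalel _ Lf)//; last exact: sqint_scale.
rewrite !(ip_scalel _ Lg)//; last exact: sqint_scale.
rewrite !(ip_scaler _ Lf)// !(ip_scaler _ Lg)//.
move=> E; rewrite -subr_ge0.
have -> : (1 + r) * ip P f f + (1 + r^-1) * ip P g g -
    (ip P f f + 2 * ip P f g + ip P g g) =
  (r * (r * ip P f f) + 2 * (r * (-1 * ip P f g)) + -1 * (-1 * ip P g g)) / r.
  by field; rewrite gt_eqF.
by rewrite divr_ge0// ltW.
Qed.

Lemma ip_add_orthogonal c f g : sqint P f -> sqint P g -> ip P g f = 0 ->
  ip P (fun w => f w + c * g w) (fun w => f w + c * g w) =
  ip P f f + c ^+ 2 * ip P g g.
Proof.
move=> Lf Lg gf0; have Lcg := sqint_scale c Lg.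
rewrite ip_add_sqr// (ip_scaler _ Lg Lf) (ipC _ f g) gf0.
by rewrite (ip_scalel _ Lg Lcg) (ip_scaler _ Lg Lg); ring.
Qed.

End ip_geometry.

Lemma discrete_gronwall (R : realType) (h M : R) (a : nat -> R) (N : nat) :
  0 <= h -> 0 <= M -> a 0%N <= 0 ->
  (forall k, (k < N)%N -> a k.+1 <= (1 + h) * a k + M) ->
  forall k, (k <= N)%N -> a k <= M * k%:R * expR (k%:R * h).
Proof.
move=> h0 M0 a0 aS k kN.
have h10 : 0 <= 1 + h by rewrite addr_ge0.
suff: a k <= M * k%:R * (1 + h) ^+ k.
  move=> /le_trans; apply; apply: ler_wpM2l; first exact: mulr_ge0.
  by rewrite (mulrC k%:R) expRM_natr lerXn2r ?nnegrE ?expR_ge0// expR_ge1Dx.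
elim: k kN => [_|k IH kN]; first by rewrite mulr0 mul0r.
apply: (le_trans (aS _ kN)).
apply: (@le_trans _ _ ((1 + h) * (M * k%:R * (1 + h) ^+ k) + M * (1 + h) ^+ k.+1)).
  apply: lerD; first by apply: ler_wpM2l => //; apply: IH; exact: ltnW.
  by rewrite ler_peMr// exprn_ege1// lerDl.
by rewrite exprS -natr1 le_eqVlt; apply/orP; left; apply/eqP; ring.
Qed.
(** * Linear growth and order two *)

Section past_more.
Context d (Omega : measurableType d) (R : realType) (P : probability Omega R).
Local Notation mu := (@lebesgue_measure R).
Variables (B : R -> Omega -> R) (hB : brownian_like P B).
Implicit Types (t c e a b r : R).

Lemma past_sub t Z Z' : 0 <= t -> past P B t Z -> past P B t Z' ->
  past P B t (fun w => Z w - Z' w).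
Proof.
move=> t0 pZ pZ'; have := past_add hB t0 pZ (past_scale hB (-1) t0 pZ').
by congr past; apply/funext => w; rewrite mulN1r.
Qed.

Lemma ae_eq_past t Z Z' : 0 <= t -> measurable_fun setT Z' ->
  {ae P, forall w, Z w = Z' w} -> past P B t Z -> past P B t Z'.
Proof.
move=> t0 mZ' ZZ' [LZ Z0]; split; first exact: ae_eq_sqint ZZ' LZ.
move=> a s ta as_; rewrite -(Z0 a s ta as_).
have mI : measurable_fun setT (fun w => B s w - B a w).
  by apply: measurable_funB; exact: bl_measurable hB _.
apply: ae_eq_ip => //; first by case: LZ.
  by apply: aeW.
by apply: filterS ZZ' => w ->.
Qed.

Lemma step_functional_cstE a b c r w :
  step_functional B a b c (fun=> r) w =
  c * (B b w - B a w) + r * \int[mu]_(s in `[a, b]) (B s w - B a w).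
Proof.
rewrite /step_functional RintegralZl//; apply: continuous_integrable_itv => s.
by apply: cvgB; [exact: (bl_continuous hB)|exact: cvg_cst].
Qed.

End past_more.

Section order_and_energy.
Context d (Omega : measurableType d) (R : realType) (P : probability Omega R).
Local Notation mu := (@lebesgue_measure R).
Variables (W : R -> {RV P >-> R}) (B : R -> Omega -> R).
Hypotheses (hB : brownian_like P B)
  (BW : {ae P, forall w, forall s, 0 <= s -> B s w = W s w}).
Variables (sigma p0 q0 s : R) (s6 : s ^+ 2 = 6).
Local Notation b1 := ((- 2 + s) / 6).
Local Notation d1 := (1 - s / 3).
Local Notation d2 := (1 + s / 3).
Variable y : R -> nat -> {RV P >-> (R * R)%type}.
Hypothesis hy :
  forall h : R, 0 < h -> ssrk_solution W sigma p0 q0 b1 h (y h).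

Let combine (h hV a b c e E E' V V' S g M : R) :
  E <= (1 + h) * a + (1 + hV) * c -> E' <= (1 + h) * b + (1 + hV) * e ->
  g * (V + V') <= g * (20 * M) -> (1 + hV) * (c + e) <= 4 * S * M ->
  E + g * V + (E' + g * V') <= (1 + h) * (a + b) + (4 * S + 20 * g) * M.
Proof. lra. Qed.

Let combineV (h a b V V' : R) :
  V <= 2 * a * h + 2 * (2 * h) ^+ 2 * h ^+ 3 ->
  V' <= 2 * b * h + 2 * (2 * h) ^+ 2 * h ^+ 3 ->
  a * h <= h ^+ 5 -> b * h <= h ^+ 5 -> V + V' <= 20 * h ^+ 5.
Proof. lra. Qed.

Section fixed_step.
Variables (h : R) (h0 : 0 < h).

Let t_ k : R := k%:R * h.
Let t_ge0 k : 0 <= t_ k. Proof. by rewrite mulr_ge0// ltW. Qed.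
Let t_lt k : t_ k < t_ k.+1. Proof. by rewrite ltr_pM2r// ltr_nat. Qed.
Let t_step k : t_ k.+1 - t_ k = h.
Proof. by rewrite /t_ -natr1; ring. Qed.

Let p k w : R := (y h k w).1.
Let q k w : R := (y h k w).2.
Let mp k : measurable_fun setT (p k).
Proof. by apply: (measurableT_comp measurable_fst). Qed.
Let mq k : measurable_fun setT (q k).
Proof. by apply: (measurableT_comp measurable_snd). Qed.

Let noise1 k := step_functional B (t_ k) (t_ k.+1) (nI1 b1 h)
  (fun=> nJ1 d1 d2 h).
Let noise2 k := step_functional B (t_ k) (t_ k.+1) (nI2 b1 h)
  (fun=> nJ2 d1 d2 h).

Lemma ssrk_recursion : {ae P, forall w, p 0 w = p0 /\ q 0 w = q0 /\
  forall k, p k.+1 w = rot1 h * p k w - rot2 h * q k w + sigma * noise1 k w /\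
            q k.+1 w = rot2 h * p k w + rot1 h * q k w + sigma * noise2 k w}.
Proof.
apply: filterS2 BW (hy h0) => w BWw [y0 yS]; rewrite /p /q y0; split=> //; split=> // k.
have := ssrk_stepE (lt0r_neq0 h0) (yS k); rewrite ssrk_d1E// ssrk_d2E//=.
have -> : wiener_I W h k w = B (t_ k.+1) w - B (t_ k) w.
  by rewrite /wiener_I !BWw.
have -> : wiener_I10 W h k w =
    \int[mu]_(u in `[t_ k, t_ k.+1]) (B u w - B (t_ k) w).
  apply: eq_Rintegral => u; rewrite inE/= in_itv/= => /andP[ku _].
  by rewrite !BWw// (le_trans (t_ge0 k)).
by rewrite /noise1 /noise2 !(step_functional_cstE hB).
Qed.

Let cst_cont (r : R) : continuous (fun _ : R => r).
Proof. by move=> x; exact: cvg_cst. Qed.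

Let cst_bound (r : R) k u : t_ k <= u <= t_ k.+1 -> `|r| <= `|r|.
Proof. by []. Qed.

Let past_noise1 k : past P B (t_ k.+1) (noise1 k).
Proof.
exact: (past_step_functional hB _ (t_ge0 k) (t_lt k) (@cst_cont _) (@cst_bound _ k)).
Qed.

Let past_noise2 k : past P B (t_ k.+1) (noise2 k).
Proof.
exact: (past_step_functional hB _ (t_ge0 k) (t_lt k) (@cst_cont _) (@cst_bound _ k)).
Qed.

(** The numerical solution is only almost surely given by the recursion, whence
    the stability of [past] under almost sure equality. *)
Lemma past_ssrk k : past P B (t_ k) (p k) /\ past P B (t_ k) (q k).
Proof.
elim: k => [|k [pp pq]].
  split.
    apply: (ae_eq_past hB (t_ge0 0) (mp 0) _ (past_cst hB p0 (t_ge0 0))).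
    by apply: filterS ssrk_recursion => w [-> _].
  apply: (ae_eq_past hB (t_ge0 0) (mq 0) _ (past_cst hB q0 (t_ge0 0))).
  by apply: filterS ssrk_recursion => w [_ [-> _]].
have tk := ltW (t_lt k); have t0 := t_ge0 k.+1.
have {}pp := past_le tk pp; have {}pq := past_le tk pq.
split.
  apply: (ae_eq_past hB t0 (mp k.+1)); last first.
    apply: (past_add hB t0 _ (past_scale hB sigma t0 (past_noise1 k))).
    exact: (past_sub hB t0 (past_scale hB (rot1 h) t0 pp)
      (past_scale hB (rot2 h) t0 pq)).
  by apply: filterS ssrk_recursion => w [_ [_ /(_ k)[-> _]]].
apply: (ae_eq_past hB t0 (mq k.+1)); last first.
  apply: (past_add hB t0 _ (past_scale hB sigma t0 (past_noise2 k))).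
  exact: (past_add hB t0 (past_scale hB (rot2 h) t0 pp)
    (past_scale hB (rot1 h) t0 pq)).
by apply: filterS ssrk_recursion => w [_ [_ /(_ k)[_ ->]]].
Qed.

(** The rotation preserves the sum of the second moments, the noise is
    orthogonal to the rotated state, and its second moment is [h], up to the
    factor [sigma ^ 2]. *)
Lemma ssrk_energy k :
  ip P (p k) (p k) + ip P (q k) (q k) =
  p0 ^+ 2 + q0 ^+ 2 + sigma ^+ 2 * (k%:R * h).
Proof.
elim: k => [|k IH].
  rewrite mul0r mulr0 addr0 -!(ip_cst P).
  by congr (_ + _); apply: ae_eq_ip => //; apply: filterS ssrk_recursion => w [? []].
have [pp pq] := past_ssrk k; have [[Lp _] [Lq _]] := (pp, pq).
have t0 := t_ge0 k.
have pA1 := past_sub hB t0 (past_scale hB (rot1 h) t0 pp)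
  (past_scale hB (rot2 h) t0 pq).
have pA2 := past_add hB t0 (past_scale hB (rot2 h) t0 pp)
  (past_scale hB (rot1 h) t0 pq).
have Ln1 : sqint P (noise1 k) by case: (past_noise1 k).
have Ln2 : sqint P (noise2 k) by case: (past_noise2 k).
have mS1 := (sqint_add (pA1.1) (sqint_scale sigma Ln1)).1.
have mS2 := (sqint_add (pA2.1) (sqint_scale sigma Ln2)).1.
rewrite (ae_eq_ip (mp k.+1) (mp k.+1) mS1 mS1); [|
  by apply: filterS ssrk_recursion => w [_ [_ /(_ k)[-> _]]] ..].
rewrite (ae_eq_ip (mq k.+1) (mq k.+1) mS2 mS2); [|
  by apply: filterS ssrk_recursion => w [_ [_ /(_ k)[_ ->]]] ..].
have orth1 := ip_step_functional_past hB (nI1 b1 h) (t_ge0 k) (t_lt k)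
  (@cst_cont _) (@cst_bound (nJ1 d1 d2 h) k) pA1.
have orth2 := ip_step_functional_past hB (nI2 b1 h) (t_ge0 k) (t_lt k)
  (@cst_cont _) (@cst_bound (nJ2 d1 d2 h) k) pA2.
rewrite (ip_add_orthogonal _ pA1.1 Ln1 orth1).
rewrite (ip_add_orthogonal _ pA2.1 Ln2 orth2).
have := ip_rotation (rot1 h) (rot2 h) Lp Lq; rewrite rot_unit mul1r IH => E.
have V1 := step_functional_cst_var hB (nI1 b1 h) (nJ1 d1 d2 h) (t_ge0 k) (t_lt k).
have V2 := step_functional_cst_var hB (nI2 b1 h) (nJ2 d1 d2 h) (t_ge0 k) (t_lt k).
rewrite t_step in V1 V2; have V := noise_variance s6 (lt0r_neq0 h0).
have -> : k.+1%:R * h = k%:R * h + h by rewrite -natr1; ring.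
rewrite addrACA E /noise1 /noise2 V1 V2 -[X in _ = _ + _ * (_ + X)]V; ring.
Qed.

Section error.
Variable X : R -> {RV P >-> (R * R)%type}.
Hypothesis hX : sho_solution W sigma p0 q0 X.

Let xp k w : R := (X (t_ k) w).1.
Let xq k w : R := (X (t_ k) w).2.
Let exact1 k := step_functional B (t_ k) (t_ k.+1) 1
  (fun u => - sin (t_ k.+1 - u)).
Let exact2 k := step_functional B (t_ k) (t_ k.+1) 0
  (fun u => cos (t_ k.+1 - u)).

Lemma sho_recursion : {ae P, forall w, xp 0 w = p0 /\ xq 0 w = q0 /\
  forall k, xp k.+1 w = cos h * xp k w - sin h * xq k w + sigma * exact1 k w /\
            xq k.+1 w = sin h * xp k w + cos h * xq k w + sigma * exact2 k w}.
Proof.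
apply: filterS2 BW hX => w BWw [cX EX].
have t00 : t_ 0 = 0 by rewrite /t_ mul0r.
pose x1 t := (X (Num.max 0 t) w).1; pose x2 t := (X (Num.max 0 t) w).2.
have cXm := continuous_within_clamp cX.
have cx1 : continuous x1.
  by move=> t; apply: (cvg_comp (fun t : R => X (Num.max 0 t) w) fst (cXm t)); exact: cvg_fst.
have cx2 : continuous x2.
  by move=> t; apply: (cvg_comp (fun t : R => X (Num.max 0 t) w) snd (cXm t)); exact: cvg_snd.
have x1E t : 0 <= t -> x1 t = (X t w).1 by move=> t0; rewrite /x1 max_r.
have x2E t : 0 <= t -> x2 t = (X t w).2 by move=> t0; rewrite /x2 max_r.
have Ep t : 0 <= t -> x1 t = p0 + \int[mu]_(u in `[0, t]) (- x2 u)
    + sigma * (B t w - B 0 w).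
  move=> t0; have [E1 _] := EX t t0; rewrite x1E// E1 !BWw//; congr (_ + _ + _).
  by apply: eq_Rintegral => u; rewrite inE/= in_itv/= => /andP[u0 _]; rewrite x2E.
have Eq t : 0 <= t -> x2 t = q0 + \int[mu]_(u in `[0, t]) x1 u.
  move=> t0; have [_ E2] := EX t t0; rewrite x2E// E2 /= mul0r addr0; congr (_ + _).
  by apply: eq_Rintegral => u; rewrite inE/= in_itv/= => /andP[u0 _]; rewrite x1E.
split.
  by rewrite /xp t00 -x1E// Ep// set_itv1 Rintegral_set1 subrr mulr0 !addr0.
split; first by rewrite /xq t00 -x2E// Eq// set_itv1 Rintegral_set1 addr0.
move=> k; rewrite /xp /xq -!x1E// -!x2E//.
have := sho_path_step cx1 cx2 (@bl_continuous _ _ _ _ _ hB w) Ep Eq (t_ge0 k) (t_lt k).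
by rewrite t_step.
Qed.

Let e1 k w : R := p k w - xp k w.
Let e2 k w : R := q k w - xq k w.
Let mxp k : measurable_fun setT (xp k).
Proof. by apply: (measurableT_comp measurable_fst). Qed.
Let mxq k : measurable_fun setT (xq k).
Proof. by apply: (measurableT_comp measurable_snd). Qed.
Let me1 k : measurable_fun setT (e1 k). Proof. exact: measurable_funB. Qed.
Let me2 k : measurable_fun setT (e2 k). Proof. exact: measurable_funB. Qed.

Let defect1 k := step_functional B (t_ k) (t_ k.+1) (nI1 b1 h - 1)
  (fun u => nJ1 d1 d2 h - - sin (t_ k.+1 - u)).
Let defect2 k := step_functional B (t_ k) (t_ k.+1) (nI2 b1 h - 0)
  (fun u => nJ2 d1 d2 h - cos (t_ k.+1 - u)).

(** The error is transported by the exact rotation, so that the discrepancy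
    between the two rotations acts on the numerical solution, whose second
    moment is known exactly. *)
Lemma error_recursion : {ae P, forall w, e1 0 w = 0 /\ e2 0 w = 0 /\
  forall k,
  e1 k.+1 w = ((cos h * e1 k w - sin h * e2 k w) +
    ((rot1 h - cos h) * p k w - (rot2 h - sin h) * q k w)) +
    sigma * defect1 k w /\
  e2 k.+1 w = ((sin h * e1 k w + cos h * e2 k w) +
    ((rot2 h - sin h) * p k w + (rot1 h - cos h) * q k w)) +
    sigma * defect2 k w}.
Proof.
have csin k : continuous (fun u : R => - sin (t_ k - u)).
  move=> u; apply: cvgN; apply: (cvg_comp (fun u : R => t_ k - u) sin).
    by apply: cvgB; [exact: cvg_cst|exact: cvg_id].
  exact: continuous_sin.
have ccos k : continuous (fun u : R => cos (t_ k - u)).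
  move=> u; apply: (cvg_comp (fun u : R => t_ k - u) cos).
    by apply: cvgB; [exact: cvg_cst|exact: cvg_id].
  exact: continuous_cos.
apply: filterS2 ssrk_recursion sho_recursion.
move=> w [p00 [q00 pqS]] [x00 [x01 xS]].
rewrite /e1 /e2 p00 q00 x00 x01 !subrr; split=> //; split=> // k.
have [-> ->] := pqS k; have [-> ->] := xS k.
rewrite /defect1 /defect2 -!(step_functional_sub hB)//.
by rewrite /noise1 /noise2 /exact1 /exact2; split; ring.
Qed.

Hypothesis h1 : h <= 1.

Let csin k : continuous (fun u : R => nJ1 d1 d2 h - - sin (t_ k - u)).
Proof.
move=> u; apply: cvgB; first exact: cvg_cst.
apply: cvgN; apply: (cvg_comp (fun u : R => t_ k - u) sin).
  by apply: cvgB; [exact: cvg_cst|exact: cvg_id].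
exact: continuous_sin.
Qed.

Let ccos k : continuous (fun u : R => nJ2 d1 d2 h - cos (t_ k - u)).
Proof.
move=> u; apply: cvgB; first exact: cvg_cst.
apply: (cvg_comp (fun u : R => t_ k - u) cos).
  by apply: cvgB; [exact: cvg_cst|exact: cvg_id].
exact: continuous_cos.
Qed.

Let bound1 k u : t_ k <= u <= t_ k.+1 ->
  `|nJ1 d1 d2 h - - sin (t_ k.+1 - u)| <= 2 * h.
Proof.
move=> ku; have th : t_ k.+1 - t_ k <= 1 by rewrite t_step.
have [S _] := cos_sin_near (t_ge0 k) th ku; rewrite t_step in S.
rewrite opprK (le_trans (ler_normD _ _))//.
have := nJ1_bound s6 h0 h1; move: S; lra.
Qed.

Let bound2 k u : t_ k <= u <= t_ k.+1 ->
  `|nJ2 d1 d2 h - cos (t_ k.+1 - u)| <= 2 * h.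
Proof.
move=> ku; have th : t_ k.+1 - t_ k <= 1 by rewrite t_step.
have [_ C] := cos_sin_near (t_ge0 k) th ku; rewrite t_step in C.
rewrite (_ : _ - _ = (nJ2 d1 d2 h - 1) - (cos (t_ k.+1 - u) - 1)); last by ring.
rewrite (le_trans (ler_normB _ _))//.
have := nJ2_bound s6 h0 h1; move: C; lra.
Qed.

Let past_defect1 k : past P B (t_ k.+1) (defect1 k).
Proof.
exact: (past_step_functional hB _ (t_ge0 k) (t_lt k) (@csin _) (@bound1 k)).
Qed.

Let past_defect2 k : past P B (t_ k.+1) (defect2 k).
Proof.
exact: (past_step_functional hB _ (t_ge0 k) (t_lt k) (@ccos _) (@bound2 k)).
Qed.

Let past_rotation c e f g k : past P B (t_ k) f -> past P B (t_ k) g ->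
  past P B (t_ k) (fun w => c * f w - e * g w) /\
  past P B (t_ k) (fun w => e * f w + c * g w).
Proof.
move=> pf pg; have t0 := t_ge0 k; split.
  exact: (past_sub hB t0 (past_scale hB c t0 pf) (past_scale hB e t0 pg)).
exact: (past_add hB t0 (past_scale hB e t0 pf) (past_scale hB c t0 pg)).
Qed.

Lemma past_error k : past P B (t_ k) (e1 k) /\ past P B (t_ k) (e2 k).
Proof.
elim: k => [|k [pe1 pe2]].
  split.
    apply: (ae_eq_past hB (t_ge0 0) (me1 0) _ (past_cst hB 0 (t_ge0 0))).
    by apply: filterS error_recursion => w [-> _].
  apply: (ae_eq_past hB (t_ge0 0) (me2 0) _ (past_cst hB 0 (t_ge0 0))).
  by apply: filterS error_recursion => w [_ [-> _]].
have tk := ltW (t_lt k); have t0 := t_ge0 k; have t1 := t_ge0 k.+1.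
have [pp pq] := past_ssrk k.
have [E1 E2] := past_rotation (cos h) (sin h) pe1 pe2.
have [D1 D2] := past_rotation (rot1 h - cos h) (rot2 h - sin h) pp pq.
split.
  apply: (ae_eq_past hB t1 (me1 k.+1)); last first.
    exact: (past_add hB t1 (past_le tk (past_add hB t0 E1 D1))
      (past_scale hB sigma t1 (past_defect1 k))).
  by apply: filterS error_recursion => w [_ [_ /(_ k)[-> _]]].
apply: (ae_eq_past hB t1 (me2 k.+1)); last first.
  exact: (past_add hB t1 (past_le tk (past_add hB t0 E2 D2))
    (past_scale hB sigma t1 (past_defect2 k))).
by apply: filterS error_recursion => w [_ [_ /(_ k)[_ ->]]].
Qed.

Let err k := ip P (e1 k) (e1 k) + ip P (e2 k) (e2 k).

(** Young's inequality with weight [h] costs a factor [1 + h] on the error and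
    [1 + 1 / h] on the rotation defect, whose squared size [2 * h ^ 6] becomes
    at most [4 * h ^ 5]; the two noise defects have variance at most
    [10 * h ^ 5] each. *)
Lemma error_step k S : p0 ^+ 2 + q0 ^+ 2 + sigma ^+ 2 * (k%:R * h) <= S ->
  err k.+1 <= (1 + h) * err k + (4 * S + 20 * sigma ^+ 2) * h ^+ 5.
Proof.
rewrite -ssrk_energy => hS.
have [pp pq] := past_ssrk k; have [pe1 pe2] := past_error k.
have t0 := t_ge0 k; have t1 := t_ge0 k.+1.
have [E1 E2] := past_rotation (cos h) (sin h) pe1 pe2.
have [D1 D2] := past_rotation (rot1 h - cos h) (rot2 h - sin h) pp pq.
have A1 := past_add hB t0 E1 D1; have A2 := past_add hB t0 E2 D2.
have Ld1 : sqint P (defect1 k) by case: (past_defect1 k).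
have Ld2 : sqint P (defect2 k) by case: (past_defect2 k).
have mS1 := (sqint_add A1.1 (sqint_scale sigma Ld1)).1.
have mS2 := (sqint_add A2.1 (sqint_scale sigma Ld2)).1.
rewrite {1}/err (ae_eq_ip (me1 k.+1) (me1 k.+1) mS1 mS1); [|
  by apply: filterS error_recursion => w [_ [_ /(_ k)[-> _]]] ..].
rewrite (ae_eq_ip (me2 k.+1) (me2 k.+1) mS2 mS2); [|
  by apply: filterS error_recursion => w [_ [_ /(_ k)[_ ->]]] ..].
have orth1 := ip_step_functional_past hB (nI1 b1 h - 1) (t_ge0 k) (t_lt k)
  (@csin _) (@bound1 k) A1.
have orth2 := ip_step_functional_past hB (nI2 b1 h - 0) (t_ge0 k) (t_lt k)
  (@ccos _) (@bound2 k) A2.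
rewrite (ip_add_orthogonal _ A1.1 Ld1 orth1).
rewrite (ip_add_orthogonal _ A2.1 Ld2 orth2).
have Y1 := ip_young h0 E1.1 D1.1; have Y2 := ip_young h0 E2.1 D2.1.
have RE := ip_rotation (cos h) (sin h) pe1.1 pe2.1.
rewrite cos2Dsin2 mul1r in RE.
have RD := ip_rotation (rot1 h - cos h) (rot2 h - sin h) pp.1 pq.1.
have V1 := step_functional_var hB (t_ge0 k) (t_lt k) (@csin _) (@bound1 k)
  (nI1 b1 h - 1).
have V2 := step_functional_var hB (t_ge0 k) (t_lt k) (@ccos _) (@bound2 k)
  (nI2 b1 h - 0).
rewrite t_step in V1 V2.
rewrite -/(defect1 k) in V1; rewrite -/(defect2 k) in V2.
have sqr_le (x z : R) : `|x| <= z -> x ^+ 2 <= z ^+ 2.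
  by move=> xz; rewrite -(real_normK (num_real x)) lerXn2r ?nnegrE// (le_trans _ xz).
have q1 := sqr_le _ _ (rot1_bound h0 h1).
have q2 := sqr_le _ _ (rot2_bound h0 h1).
have m1 := sqr_le _ _ (nI1_bound s6 h0 h1).
have m2 : (nI2 b1 h - 0) ^+ 2 <= (h ^+ 2) ^+ 2.
  by apply: sqr_le; rewrite subr0; exact: nI2_bound.
rewrite -!exprM/= in q1 q2 m1 m2.
have S0 : 0 <= ip P (p k) (p k) + ip P (q k) (q k) by rewrite addr_ge0 ?ip_ge0.
have hh := ltW h0.
have DD : (1 + h^-1) * (((rot1 h - cos h) ^+ 2 + (rot2 h - sin h) ^+ 2) *
    (ip P (p k) (p k) + ip P (q k) (q k))) <= 4 * S * h ^+ 5.
  have qq : (rot1 h - cos h) ^+ 2 + (rot2 h - sin h) ^+ 2 <= 2 * h ^+ 6.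
    by move: q1 q2; lra.
  apply: (@le_trans _ _ ((1 + h^-1) * (2 * h ^+ 6 * S))).
    apply: ler_wpM2l; first by rewrite addr_ge0// invr_ge0.
    by apply: ler_pM => //; rewrite addr_ge0 ?sqr_ge0.
  have -> : (1 + h^-1) * (2 * h ^+ 6 * S) = 2 * S * h ^+ 5 * (h + 1).
    by field; rewrite gt_eqF.
  have -> : 4 * S * h ^+ 5 = 2 * S * h ^+ 5 * 2 by ring.
  apply: ler_wpM2l; last by rewrite lerD2r.
  by rewrite !mulr_ge0 ?exprn_ge0// (le_trans S0).
have VV : ip P (defect1 k) (defect1 k) + ip P (defect2 k) (defect2 k) <=
    20 * h ^+ 5.
  have n1 := ler_wpM2r hh m1; have n2 := ler_wpM2r hh m2.
  rewrite -exprSr in n1 n2.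
  by move: V1 V2 n1 n2; exact: combineV.
have VS := ler_wpM2l (sqr_ge0 sigma) VV.
have EE : err k = ip P (fun w => cos h * e1 k w - sin h * e2 k w)
      (fun w => cos h * e1 k w - sin h * e2 k w) +
    ip P (fun w => sin h * e1 k w + cos h * e2 k w)
      (fun w => sin h * e1 k w + cos h * e2 k w) by rewrite RE.
rewrite -RD in DD; rewrite EE.
move: Y1 Y2 VS DD; exact: combine.
Qed.

Lemma error_bound T k : k%:R * h <= T ->
  ('E_P[fun w => (euclid_norm (y h k w - X (k%:R * h) w) ^+ 2)%R] <=
   ((4 * (p0 ^+ 2 + q0 ^+ 2 + sigma ^+ 2 * T) + 20 * sigma ^+ 2) * T * expR T
     * h ^+ 4)%:E)%E.
Proof.
move=> kT; set S := p0 ^+ 2 + q0 ^+ 2 + sigma ^+ 2 * T.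
have [[Le1 _] [Le2 _]] := past_error k.
rewrite [X in ('E_P[X] <= _)%E](_ : _ =
    fun w => (e1 k w ^+ 2 + e2 k w ^+ 2) * 1); last first.
  by apply/funext => w; rewrite mulr1 sqr_sqrtr// addr_ge0 ?sqr_ge0.
rewrite (expectation_sum_sqr _ Le1 Le2) mulr1 lee_fin -/(err k).
have T0 : 0 <= T by exact: le_trans (t_ge0 k) kT.
have hh := ltW h0.
have S0 : 0 <= S by rewrite !addr_ge0 ?sqr_ge0// mulr_ge0 ?sqr_ge0.
pose M := 4 * S + 20 * sigma ^+ 2.
have M0 : 0 <= M by rewrite addr_ge0// mulr_ge0 ?sqr_ge0.
have err0 : err 0 <= 0.
  have m0 : measurable_fun [set: Omega] (fun=> (0 : R)) by [].
  rewrite /err (ae_eq_ip (me1 0) (me1 0) m0 m0); [|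
    by apply: filterS error_recursion => w [-> _] ..].
  rewrite (ae_eq_ip (me2 0) (me2 0) m0 m0); [|
    by apply: filterS error_recursion => w [_ [-> _]] ..].
  by rewrite ip_cst expr0n addr0.
have step j : (j < k)%N -> err j.+1 <= (1 + h) * err j + M * h ^+ 5.
  move=> jk; apply: error_step; rewrite lerD2l; apply: ler_wpM2l.
    exact: sqr_ge0.
  by apply: le_trans kT; rewrite ler_pM2r// ler_nat ltnW.
have M50 : 0 <= M * h ^+ 5 by rewrite mulr_ge0// exprn_ge0.
apply: (le_trans (discrete_gronwall hh M50 err0 step (leqnn k))).
rewrite -/M (_ : M * h ^+ 5 * k%:R = M * h ^+ 4 * (k%:R * h)); last by ring.
rewrite (_ : M * T * expR T * h ^+ 4 = M * h ^+ 4 * T * expR T); last by ring.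
have M40 : 0 <= M * h ^+ 4 by rewrite mulr_ge0// exprn_ge0.
have kh0 : 0 <= k%:R * h by exact: t_ge0.
apply: ler_pM; rewrite ?expR_ge0 ?ler_expR//; first exact: mulr_ge0.
exact: ler_wpM2l.
Qed.

End error.
End fixed_step.
End order_and_energy.

Theorem mainTheorem5 (R : realType) (d : measure_display)
    (Omega : measurableType d) (P : probability Omega R)
    (W : R -> {RV P >-> R}) (hW : wiener_process W)
    (sigma p0 q0 b1 : R)
    (hb1 : b1 = (- 2 + Num.sqrt 6) / 6 \/ b1 = (- 2 - Num.sqrt 6) / 6)
    (y : R -> nat -> {RV P >-> (R * R)%type})
    (hy : forall h : R, 0 < h -> ssrk_solution W sigma p0 q0 b1 h (y h)) :
  (forall X : R -> {RV P >-> (R * R)%type},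
     sho_solution W sigma p0 q0 X ->
     forall T : R, 0 < T -> mean_square_order X y T 2) /\
  (forall h : R, 0 < h -> forall k : nat,
     'E_P[fun w => H0 (y h k w)]%E =
       (2^-1 * (p0 ^+ 2 + q0 ^+ 2) + 2^-1 * sigma ^+ 2 * (k%:R * h))%:E).
Proof.
have [B [hB BW]] := wiener_continuous_version hW.
have [s [s6 b1E]] : exists s : R, s ^+ 2 = 6 /\ b1 = (- 2 + s) / 6.
  by case: hb1 => ->; [exists (Num.sqrt 6)|exists (- Num.sqrt 6)];
    rewrite ?sqrrN sqr_sqrtr.
subst b1; split=> [X hX T T0|h h0 k]; last first.
  have [[Lp _] [Lq _]] := past_ssrk hB BW s6 hy h0 k.
  rewrite /H0 (expectation_sum_sqr _ Lp Lq).
  by rewrite (ssrk_energy hB BW s6 hy h0); congr EFin; ring.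
pose K : R := (4 * (p0 ^+ 2 + q0 ^+ 2 + sigma ^+ 2 * T) + 20 * sigma ^+ 2)
  * T * expR T.
have K0 : 0 <= K.
  have T0' := ltW T0.
  have S0 : 0 <= p0 ^+ 2 + q0 ^+ 2 + sigma ^+ 2 * T.
    by rewrite !addr_ge0 ?sqr_ge0// mulr_ge0 ?sqr_ge0.
  rewrite !mulr_ge0 ?expR_ge0// addr_ge0//; last by rewrite mulr_ge0 ?sqr_ge0.
  exact: mulr_ge0.
exists (Num.sqrt K); near=> N => k kN /=.
have N0 : 0 < N%:R :> R by rewrite ltr0n; near: N; exact: nbhs_infty_gt.
have TN : T <= N%:R by near: N; exact: nbhs_infty_ger.
set h := T / N%:R; have h0 : 0 < h by exact: divr_gt0.
have h1 : h <= 1 by rewrite ler_pdivrMr// mul1r.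
have kT : k%:R * h <= T.
  by rewrite mulrCA ger_pMr// ler_pdivrMr// mul1r ler_nat.
have := error_bound hB BW s6 hy h0 hX h1 kT; rewrite -/K => EK.
apply: (@le_trans _ _ (poweR (K * h ^+ 4)%:E 2^-1)).
  apply: gt0_ler_poweR => //; rewrite ?in_itv/= ?leey ?andbT.
    by apply: expectation_ge0 => w; exact: sqr_ge0.
  by rewrite lee_fin mulr_ge0// exprn_ge0// ltW.
rewrite poweR_EFin lee_fin powR12_sqrt; last by rewrite mulr_ge0// exprn_ge0// ltW.
rewrite powR_mulrn; last exact: ltW.
rewrite sqrtrM// (_ : h ^+ 4 = (h ^+ 2) ^+ 2); last by ring.
by rewrite sqrtr_sqr ger0_norm ?sqr_ge0.
Unshelve. all: by end_near. Qed.
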